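(* Let $N\ge 1$, let $\Omega\subset\mathbb{R}^N$ be a bounded open domain with $C^1$ boundary and outward unit normal $\nu$, and let $g^\pm\in C^1(\overline\Omega)$ with $g^-(x)<g^+(x)$ for $x\in\overline\Omega$. Let $F\in C(\mathcal{S}(N+1)\times\mathbb{R}^{N+1}\times\mathbb{R}\times\overline\Omega\times[-1,1],\mathbb{R})$ and suppose there is a constant $\alpha>0$ such that, for every $(p,x,y)\in\mathbb{R}^{N+1}\times\overline\Omega\times[-1,1]$, $F(X,p,r,x,y)-\alpha r\le F(Y,p,s,x,y)-\alpha s$ whenever $X,Y\in\mathcal{S}(N+1)$, $r,s\in\mathbb{R}$, $X\ge Y$ and $r\le s$. Let $\gamma_1^\pm\in C(\overline\Omega\times[-1,1],\mathbb{R}^N)$, $\beta^\pm\in C(\overline\Omega\times[-1,1],\mathbb{R})$ and put $\gamma^+=(\gamma_1^+,1)$, $\gamma^-=(\gamma_1^-,-1)$. Assume that there are $\gamma_o\in C^1(\overline\Omega,\mathbb{R}^N)$, $\beta_o\in C^1(\overline\Omega,\mathbb{R})$ with $$\gamma_1^+(x,0)=-\gamma_1^-(x,0)=\gamma_o(x),\qquad \beta^+(x,0)=-\beta^-(x,0)=\beta_o(x)\qquad (x\in\overline\Omega),$$ and $k^\pm\in C(\overline\Omega,\mathbb{R}^N)$, $l^\pm\in C(\overline\Omega,\mathbb{R})$ such that, as $y\to0$, uniformly in $x\in\overline\Omega$, $$\gamma_1^\pm(x,y)=\pm\gamma_o(x)+k^\pm(x)y+o(|y|),\qquad \beta^\pm(x,y)=\pm\beta_o(x)+l^\pm(x)y+o(|y|).$$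 Let $\beta\in C(\partial\Omega\times[-1,1],\mathbb{R})$ and consider, on $\partial_{\mathrm L}\Omega_\varepsilon$, either (O) the oblique condition $\gamma\cdot Du=\beta$, where $\gamma=(\gamma_1,\gamma_2)\in C(\partial\Omega\times[-1,1],\mathbb{R}^{N+1})$ satisfies $\gamma_1(x,y)\cdot\nu(x)>0$ for $(x,y)\in\partial\Omega\times[-1,1]$ and $\gamma_2(x,0)=0$ for $x\in\partial\Omega$ (this includes the Neumann case $\gamma=(\nu,0)$, $\beta=0$); or (D) the Dirichlet condition $u=\beta$. Let $(\mathrm P_\varepsilon)$ be the problem $$F(D^2u,Du,u,x,y)=0\ \text{in }\Omega_\varepsilon,\quad \gamma^+\cdot Du=\beta^+\ \text{on }\partial_{\mathrm T}\Omega_\varepsilon,\quad \gamma^-\cdot Du=\beta^-\ \text{on }\partial_{\mathrm B}\Omega_\varepsilon$$ with the chosen lateral condition on $\partial_{\mathrm L}\Omega_\varepsilon$, and let $(\mathrm P_0)$ be the problem $G(D^2u,Du,u,x)=0$ in $\Omega$ with, on $\partial\Omega$, the condition $\gamma_1(x,0)\cdot Du=\beta(x,0)$ in case (O), respectively $u=\beta(x,0)$ in case (D), where $G$ is the limit operator defined in the context. Assume that the comparison principle holds for $(\mathrm P_0)$: if $v$ and $w$ are a viscosity subsolution and a viscosity supersolution of $(\mathrm P_0)$, respectively, then $v\le w$ on $\overline\Omega$. Let $\varepsilon_1\in(0,\varepsilon_0)$ and $C_0>0$ and, for every $0<\varepsilon<\varepsilon_1$, let $u^\varepsilon$ be a viscosity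 solution of $(\mathrm P_\varepsilon)$ with $\sup_{\overline{\Omega_\varepsilon}}|u^\varepsilon|\le C_0$. Then there is a (unique) viscosity solution $u^0$ of $(\mathrm P_0)$ and $$\lim_{\varepsilon\to0^+}\ \sup_{(x,y)\in\overline{\Omega_\varepsilon}}|u^\varepsilon(x,y)-u^0(x)|=0.$$
   Context: $\mathcal{S}(k)$ is the space of real symmetric $k\times k$ matrices with the semidefinite order. For compact $K\subset\mathbb{R}^j$, $C^i(K,\mathbb{R}^k)$ denotes restrictions to $K$ of $C^i$ functions on $\mathbb{R}^j$. For $\varepsilon>0$: $\Omega_\varepsilon=\{(x,y)\in\Omega\times\mathbb{R}: \varepsilon g^-(x)<y<\varepsilon g^+(x)\}$, $\partial_{\mathrm T}\Omega_\varepsilon=\{(x,y): x\in\overline\Omega,\ y=\varepsilon g^+(x)\}$, $\partial_{\mathrm B}\Omega_\varepsilon=\{(x,y): x\in\overline\Omega,\ y=\varepsilon g^-(x)\}$, $\partial_{\mathrm L}\Omega_\varepsilon=\{(x,y): x\in\partial\Omega,\ \varepsilon g^-(x)\le y\le\varepsilon g^+(x)\}$. The constant $\varepsilon_0>0$ is fixed so small that for all $0<\varepsilon<\varepsilon_0$: $\overline{\Omega_\varepsilon}\subset\overline\Omega\times[-1,1]$, $1-\varepsilon Dg^+\cdot\gamma_1^+>0$ on $\partial_{\mathrm T}\Omega_\varepsilon$, and $1+\varepsilon Dg^-\cdot\gamma_1^->0$ on $\partial_{\mathrm B}\Omega_\varepsilon$. Limit operator. Vectors are row vectors; $D\gamma_o$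 is the matrix with $(i,j)$ entry $\partial(\gamma_o)_i/\partial x_j$; $D\beta_o$ is the row vector with entries $\partial\beta_o/\partial x_i$. Put $$b=\gamma_o(D\gamma_o)^{T}-\frac{g^+k^++g^-k^-}{g^+-g^-},\qquad c=-\gamma_o\cdot D\beta_o+\frac{g^+l^++g^-l^-}{g^+-g^-},$$ and for $(X,p,r,x)\in\mathcal{S}(N)\times\mathbb{R}^N\times\mathbb{R}\times\overline\Omega$ $$G(X,p,r,x)=F\big(A+B+C,\ (p,\beta_o(x)-\gamma_o(x)\cdot p),\ r,\ x,\ 0\big),$$ $$A=\begin{pmatrix}X&-X\gamma_o^{T}\\-\gamma_oX&\gamma_oX\gamma_o^{T}\end{pmatrix},\quad B=\begin{pmatrix}0&-(pD\gamma_o)^{T}\\-pD\gamma_o&b\cdot p\end{pmatrix},\quad C=\begin{pmatrix}0&(D\beta_o)^{T}\\ D\beta_o&c\end{pmatrix},$$ with all functions evaluated at $x$. Viscosity solutions of $(\mathrm P_\varepsilon)$. A bounded function $u$ on $\overline{\Omega_\varepsilon}$ is a viscosity subsolution if, with $v$ its upper semicontinuous envelope on $\overline{\Omega_\varepsilon}$, whenever $\phi\in C^2(\overline{\Omega_\varepsilon})$ and $v-\phi$ attains its maximum over $\overline{\Omega_\varepsilon}$ at $\hat z$, at least one of the following holds: (a) $F(D^2\phi(\hat z),D\phi(\hat z),v(\hat z),\hat z)\le0$; (b) $\hat z\in\partial_{\mathrm L}\Omega_\varepsilon$ and $\gamma(\hat z)\cdot D\phi(\hat z)\le\beta(\hat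 z)$ in case (O), respectively $v(\hat z)\le\beta(\hat z)$ in case (D); (c) $\hat z\in\partial_{\mathrm T}\Omega_\varepsilon$ and $\gamma^+(\hat z)\cdot D\phi(\hat z)\le\beta^+(\hat z)$; (d) $\hat z\in\partial_{\mathrm B}\Omega_\varepsilon$ and $\gamma^-(\hat z)\cdot D\phi(\hat z)\le\beta^-(\hat z)$. Viscosity supersolutions: replace maximum by minimum, $\le$ by $\ge$, upper by lower semicontinuous envelope. A viscosity solution is a bounded function that is both (continuity is not required). Viscosity solutions of $(\mathrm P_0)$. A bounded function $u$ on $\overline\Omega$ is a viscosity subsolution if, with $v$ its upper semicontinuous envelope on $\overline\Omega$, whenever $\phi\in C^2(\overline\Omega)$ and $v-\phi$ attains its maximum over $\overline\Omega$ at $\hat x$, one has $G(D^2\phi(\hat x),D\phi(\hat x),v(\hat x),\hat x)\le0$, or else $\hat x\in\partial\Omega$ and $\gamma_1(\hat x,0)\cdot D\phi(\hat x)\le\beta(\hat x,0)$ in case (O), respectively $v(\hat x)\le\beta(\hat x,0)$ in case (D). Supersolutions are defined symmetrically (minimum, $\ge$, lower semicontinuous envelope); a viscosity solution is both. *)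

(* Defs.v *)
From HB Require Import structures.
From mathcomp Require Import all_boot all_order all_algebra.
From mathcomp Require Import all_classical all_reals all_analysis.
Set Implicit Arguments.
Unset Strict Implicit.
Unset Printing Implicit Defensive.
Import Order.TTheory GRing.Theory Num.Theory.
Import numFieldNormedType.Exports.
Local Open Scope classical_set_scope.
Local Open Scope ring_scope.

(* Conventions.  Vectors are row vectors, and the point (x, y) of R^N x R is
   [row_mx x y%:M : 'rV_(N + 1)].  A function on a subset K of R^j is given by
   a total function of which only the values on K matter.  A function of class
   C^i (i = 1, 2) on a compact K is by definition the restriction of a C^i
   function on R^j; it is represented by such an extension.  All the sets K at
   hand are closures of open sets, so the derivatives at points of K do not
   depend on the extension. *)

Definition dot (R : realType) (n : nat) (u v : 'rV[R]_n) : R :=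
  \sum_(i < n) u 0 i * v 0 i.

Definition symmx (R : realType) (n : nat) : set 'M[R]_n :=
  [set X | X^T = X].

Definition psd_le (R : realType) (n : nat) (Y X : 'M[R]_n) : Prop :=
  forall v : 'rV[R]_n, 0 <= dot (v *m (X - Y)) v.

Definition partial (R : realType) (n : nat) (i : 'I_n) (f : 'rV[R]_n -> R)
    (x : 'rV[R]_n) : R :=
  'D_(delta_mx 0 i) f x.

Definition grad (R : realType) (n : nat) (f : 'rV[R]_n -> R) (x : 'rV[R]_n) :
    'rV[R]_n :=
  \row_i partial i f x.

Definition hess (R : realType) (n : nat) (f : 'rV[R]_n -> R) (x : 'rV[R]_n) :
    'M[R]_n :=
  \matrix_(i, j) partial i (partial j f) x.

(* Entry (i, j) is the j-th partial derivative of the i-th component: this is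
   the transpose of the library's [jacobian]. *)
Definition Dmx (R : realType) (m n : nat) (f : 'rV[R]_n -> 'rV[R]_m)
    (x : 'rV[R]_n) : 'M[R]_(m, n) :=
  \matrix_(i, j) partial j (fun z => f z 0 i) x.

Definition C1 (R : realType) (n : nat) (f : 'rV[R]_n -> R) : Prop :=
  (forall x, differentiable f x) /\ (forall i, continuous (partial i f)).

Definition C2 (R : realType) (n : nat) (f : 'rV[R]_n -> R) : Prop :=
  C1 f /\ (forall i, C1 (partial i f)).

Definition C1v (R : realType) (m n : nat) (f : 'rV[R]_n -> 'rV[R]_m) : Prop :=
  forall i, C1 (fun x => f x 0 i).

Definition bdry (T : topologicalType) (A : set T) : set T :=
  closure A `\` interior A.

Definition bounded_domain (R : realType) (N : nat) (Omega : set 'rV[R]_N) :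
    Prop :=
  [/\ Omega !=set0, open Omega, connected Omega & bounded_set Omega].

(* Since Omega is open, such a rho vanishes at the boundary point x, and near x
   the boundary is the C^1 hypersurface rho = 0, with Omega on one side. *)
Definition C1_defining (R : realType) (N : nat) (Omega : set 'rV[R]_N)
    (x : 'rV[R]_N) (rho : 'rV[R]_N -> R) : Prop :=
  [/\ C1 rho, grad rho x != 0 & \forall z \near x, Omega z <-> rho z < 0].

Definition C1_boundary (R : realType) (N : nat) (Omega : set 'rV[R]_N) : Prop :=
  forall x, bdry Omega x -> exists rho, C1_defining Omega x rho.

(* The normalisation is Euclidean: the library norm on row vectors is the
   maximum norm. *)
Definition outward_unit_normal (R : realType) (N : nat) (Omega : set 'rV[R]_N)
    (nu : 'rV[R]_N -> 'rV[R]_N) : Prop :=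
  forall x, bdry Omega x -> exists2 rho, C1_defining Omega x rho &
    nu x = (Num.sqrt (dot (grad rho x) (grad rho x)))^-1 *: grad rho x.

(* Upper and lower semicontinuous envelopes on K: the neighbourhoods are not
   punctured, and both are finite on K when u is bounded on K. *)
Definition usc_env (R : realType) (n : nat) (K : set 'rV[R]_n)
    (u : 'rV[R]_n -> R) (z : 'rV[R]_n) : R :=
  fine (limf_esup (EFin \o u) (within K (nbhs z))).

Definition lsc_env (R : realType) (n : nat) (K : set 'rV[R]_n)
    (u : 'rV[R]_n -> R) (z : 'rV[R]_n) : R :=
  fine (limf_einf (EFin \o u) (within K (nbhs z))).

(* [H X p r z] is what is required of X = D^2 phi, p = D phi and the value r of
   the envelope at the extremum point z. *)
Definition visc_sub (R : realType) (n : nat) (K : set 'rV[R]_n)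
    (H : 'M[R]_n -> 'rV[R]_n -> R -> 'rV[R]_n -> Prop) (u : 'rV[R]_n -> R) :
    Prop :=
  bounded_set (u @` K) /\
  forall (phi : 'rV[R]_n -> R) (z : 'rV[R]_n), C2 phi -> K z ->
    (forall w, K w -> usc_env K u w - phi w <= usc_env K u z - phi z) ->
    H (hess phi z) (grad phi z) (usc_env K u z) z.

Definition visc_super (R : realType) (n : nat) (K : set 'rV[R]_n)
    (H : 'M[R]_n -> 'rV[R]_n -> R -> 'rV[R]_n -> Prop) (u : 'rV[R]_n -> R) :
    Prop :=
  bounded_set (u @` K) /\
  forall (phi : 'rV[R]_n -> R) (z : 'rV[R]_n), C2 phi -> K z ->
    (forall w, K w -> lsc_env K u z - phi z <= lsc_env K u w - phi w) ->
    H (hess phi z) (grad phi z) (lsc_env K u z) z.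

Definition xpart (R : realType) (N : nat) (z : 'rV[R]_(N + 1)) : 'rV[R]_N :=
  lsubmx z.

Definition ypart (R : realType) (N : nat) (z : 'rV[R]_(N + 1)) : R :=
  rsubmx z 0 0.

Definition thin (R : realType) (N : nat) (Omega : set 'rV[R]_N)
    (gp gm : 'rV[R]_N -> R) (e : R) : set 'rV[R]_(N + 1) :=
  [set z | Omega (xpart z) /\
           e * gm (xpart z) < ypart z < e * gp (xpart z)].

Definition thin_top (R : realType) (N : nat) (Omega : set 'rV[R]_N)
    (gp : 'rV[R]_N -> R) (e : R) : set 'rV[R]_(N + 1) :=
  [set z | closure Omega (xpart z) /\ ypart z = e * gp (xpart z)].

Definition thin_bottom (R : realType) (N : nat) (Omega : set 'rV[R]_N)
    (gm : 'rV[R]_N -> R) (e : R) : set 'rV[R]_(N + 1) :=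
  [set z | closure Omega (xpart z) /\ ypart z = e * gm (xpart z)].

Definition thin_lateral (R : realType) (N : nat) (Omega : set 'rV[R]_N)
    (gp gm : 'rV[R]_N -> R) (e : R) : set 'rV[R]_(N + 1) :=
  [set z | bdry Omega (xpart z) /\
           e * gm (xpart z) <= ypart z <= e * gp (xpart z)].

(* Type of the lateral condition: [Oblique gamma1 gamma2] or [Dirichlet]. *)
Variant lateral (R : realType) (N : nat) :=
  | Oblique of ('rV[R]_N -> R -> 'rV[R]_N) & ('rV[R]_N -> R -> R)
  | Dirichlet.

Definition lateral_admissible (R : realType) (N : nat) (Omega : set 'rV[R]_N)
    (nu : 'rV[R]_N -> 'rV[R]_N) (L : lateral R N) : Prop :=
  match L with
  | Oblique gamma1 gamma2 =>
    [/\ {within bdry Omega `*` `[-1, 1],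
          continuous (fun t : 'rV[R]_N * R => gamma1 t.1 t.2)},
        {within bdry Omega `*` `[-1, 1],
          continuous (fun t : 'rV[R]_N * R => gamma2 t.1 t.2)},
        (forall x y, bdry Omega x -> -1 <= y <= 1 ->
          0 < dot (gamma1 x y) (nu x)) &
        (forall x, bdry Omega x -> gamma2 x 0 = 0)]
  | Dirichlet => True
  end.

Definition Peps_sub_cond (R : realType) (N : nat) (Omega : set 'rV[R]_N)
    (gp gm : 'rV[R]_N -> R)
    (F : 'M[R]_(N + 1) -> 'rV[R]_(N + 1) -> R -> 'rV[R]_N -> R -> R)
    (gamma1p gamma1m : 'rV[R]_N -> R -> 'rV[R]_N)
    (betap betam : 'rV[R]_N -> R -> R)
    (L : lateral R N) (beta : 'rV[R]_N -> R -> R) (e : R)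
    (X : 'M[R]_(N + 1)) (p : 'rV[R]_(N + 1)) (r : R) (z : 'rV[R]_(N + 1)) :
    Prop :=
  let x := xpart z in let y := ypart z in
  [\/ F X p r x y <= 0,
      thin_lateral Omega gp gm e z /\
        match L with
        | Oblique gamma1 gamma2 =>
          dot (row_mx (gamma1 x y) (gamma2 x y)%:M) p <= beta x y
        | Dirichlet => r <= beta x y
        end,
      thin_top Omega gp e z /\
        dot (row_mx (gamma1p x y) 1%:M) p <= betap x y |
      thin_bottom Omega gm e z /\
        dot (row_mx (gamma1m x y) (-1)%:M) p <= betam x y].

Definition Peps_super_cond (R : realType) (N : nat) (Omega : set 'rV[R]_N)
    (gp gm : 'rV[R]_N -> R)
    (F : 'M[R]_(N + 1) -> 'rV[R]_(N + 1) -> R -> 'rV[R]_N -> R -> R)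
    (gamma1p gamma1m : 'rV[R]_N -> R -> 'rV[R]_N)
    (betap betam : 'rV[R]_N -> R -> R)
    (L : lateral R N) (beta : 'rV[R]_N -> R -> R) (e : R)
    (X : 'M[R]_(N + 1)) (p : 'rV[R]_(N + 1)) (r : R) (z : 'rV[R]_(N + 1)) :
    Prop :=
  let x := xpart z in let y := ypart z in
  [\/ F X p r x y >= 0,
      thin_lateral Omega gp gm e z /\
        match L with
        | Oblique gamma1 gamma2 =>
          dot (row_mx (gamma1 x y) (gamma2 x y)%:M) p >= beta x y
        | Dirichlet => r >= beta x y
        end,
      thin_top Omega gp e z /\
        dot (row_mx (gamma1p x y) 1%:M) p >= betap x y |
      thin_bottom Omega gm e z /\
        dot (row_mx (gamma1m x y) (-1)%:M) p >= betam x y].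

Definition Peps_solution (R : realType) (N : nat) (Omega : set 'rV[R]_N)
    (gp gm : 'rV[R]_N -> R)
    (F : 'M[R]_(N + 1) -> 'rV[R]_(N + 1) -> R -> 'rV[R]_N -> R -> R)
    (gamma1p gamma1m : 'rV[R]_N -> R -> 'rV[R]_N)
    (betap betam : 'rV[R]_N -> R -> R)
    (L : lateral R N) (beta : 'rV[R]_N -> R -> R) (e : R)
    (u : 'rV[R]_(N + 1) -> R) : Prop :=
  let K := closure (thin Omega gp gm e) in
  visc_sub K
    (Peps_sub_cond Omega gp gm F gamma1p gamma1m betap betam L beta e) u /\
  visc_super K
    (Peps_super_cond Omega gp gm F gamma1p gamma1m betap betam L beta e) u.

Definition limit_op (R : realType) (N : nat) (gp gm : 'rV[R]_N -> R)
    (F : 'M[R]_(N + 1) -> 'rV[R]_(N + 1) -> R -> 'rV[R]_N -> R -> R)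
    (go : 'rV[R]_N -> 'rV[R]_N) (bo : 'rV[R]_N -> R)
    (kp km : 'rV[R]_N -> 'rV[R]_N) (lp lm : 'rV[R]_N -> R)
    (X : 'M[R]_N) (p : 'rV[R]_N) (r : R) (x : 'rV[R]_N) : R :=
  let g := go x in
  let Dg := Dmx go x in
  let Db := grad bo x in
  let b := g *m Dg^T
           - (gp x - gm x)^-1 *: (gp x *: kp x + gm x *: km x) in
  let c := - dot g Db + (gp x * lp x + gm x * lm x) / (gp x - gm x) in
  let A : 'M[R]_(N + 1) :=
    block_mx X (- (X *m g^T)) (- (g *m X)) (g *m X *m g^T) in
  let B : 'M[R]_(N + 1) :=
    block_mx 0 (- (p *m Dg)^T) (- (p *m Dg)) (dot b p)%:M in
  let C : 'M[R]_(N + 1) := block_mx 0 Db^T Db c%:M in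
  F (A + B + C) (row_mx p (bo x - dot g p)%:M) r x 0.

Definition P0_sub (R : realType) (N : nat) (Omega : set 'rV[R]_N)
    (G : 'M[R]_N -> 'rV[R]_N -> R -> 'rV[R]_N -> R)
    (L : lateral R N) (beta : 'rV[R]_N -> R -> R) (u : 'rV[R]_N -> R) : Prop :=
  visc_sub (closure Omega) (fun X p r x =>
    G X p r x <= 0 \/
    bdry Omega x /\
      match L with
      | Oblique gamma1 _ => dot (gamma1 x 0) p <= beta x 0
      | Dirichlet => r <= beta x 0
      end) u.

Definition P0_super (R : realType) (N : nat) (Omega : set 'rV[R]_N)
    (G : 'M[R]_N -> 'rV[R]_N -> R -> 'rV[R]_N -> R)
    (L : lateral R N) (beta : 'rV[R]_N -> R -> R) (u : 'rV[R]_N -> R) : Prop :=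
  visc_super (closure Omega) (fun X p r x =>
    G X p r x >= 0 \/
    bdry Omega x /\
      match L with
      | Oblique gamma1 _ => dot (gamma1 x 0) p >= beta x 0
      | Dirichlet => r >= beta x 0
      end) u.

Definition P0_solution (R : realType) (N : nat) (Omega : set 'rV[R]_N)
    (G : 'M[R]_N -> 'rV[R]_N -> R -> 'rV[R]_N -> R)
    (L : lateral R N) (beta : 'rV[R]_N -> R -> R) (u : 'rV[R]_N -> R) : Prop :=
  P0_sub Omega G L beta u /\ P0_super Omega G L beta u.

(* Main.v *)
Require Import Defs.
From HB Require Import structures.
From mathcomp Require Import all_boot all_order all_algebra.
From mathcomp Require Import all_classical all_reals all_analysis.
From mathcomp Require Import ring lra.
Import Order.TTheory GRing.Theory Num.Theory.
Import numFieldNormedType.Exports.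
Local Open Scope classical_set_scope.
Local Open Scope ring_scope.

Set Implicit Arguments.
Unset Strict Implicit.
Unset Printing Implicit Defensive.

(** The proof combines half-relaxed limits with perturbed test functions.

    Let v be the upper half-relaxed limit of the u^eps: v(x) is the upper limit
    of u^eps(x', y) as eps tends to 0 and x' tends to x.  It is upper
    semicontinuous and bounded, and the heart of the proof
    ([relaxed_limsup_sub]) is that v is a subsolution of the limit problem.
    The reflection that replaces u by -u and F(X, p, r) by -F(-X, -p, -r)
    exchanges sub- and supersolutions and commutes with the formation of the
    limit operator, so the lower half-relaxed limit w is a supersolution.
    Clearly w <= v, and comparison gives v <= w; hence v = w solves the limit
    problem.  Equality of the two half-relaxed limits means local uniform
    convergence, and compactness of the closure of Omega makes it uniform
    ([relaxed_limit_uniform]).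

    For the subsolution property let v - phi have a strict maximum at x0.
    Let v^eps be the upper semicontinuous envelope of u^eps.
    If v^eps - phi - y a(x) - m y^2 / 2 - eps s y has a maximum at a point of
    the top or bottom face, then the boundary condition at that point, expanded
    to first order in eps, is violated provided that
    a = beta_o - gamma_o . D phi cancels the terms of order 0 and the constants
    m and s make the terms of order 1 at both faces strictly positive.  The
    threshold value of m and the slope a are exactly the vertical entries of the
    arguments of F in the limit operator G ([limit_mxE]); taking m larger than
    the threshold by k leaves a positive margin, which s splits evenly between
    the two faces ([boundary_expansion]).  So at the maximum point either the
    equation or the lateral condition holds, and both pass to the limit
    ([interior_limit], [lateral_limit]).

    The difficulty is that a is only C^1, so the function above is not an
    admissible test function.  It is replaced by a function depending on an
    auxiliary centre xi,
      phi(x) + y (a(xi) + q . (x - xi)) + k |x - xi|^2 / 2 + m y^2 / 2 + eps s y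
    with q = Da(x0), and the maximum is taken over x, y and xi together
    ([penalised_maxima]).  For fixed xi this is phi plus a quadratic polynomial.
    Comparing the maximising xi with xi = x, and using that a is strictly
    differentiable at x0, yields |x - xi| = o(eps) ([maxima_h_cvg]): the error
    made in replacing a(x) by its affine approximation at xi, and the gradient
    of the penalty, are then too small to disturb the expansion at order eps.
    The penalty adds k to the Hessian, which disappears when k tends to 0. *)

(** * Directional derivatives and the symmetry of the Hessian *)
Section Directional.
Variables (R : realType) (n : nat).
Implicit Types (f g : 'rV[R]_n -> R) (x v w : 'rV[R]_n).

Lemma derive_line f x v t :
  (derivable (fun s : R => f (x + s *: v)) t 1 = derivable f (x + t *: v) v) *
  ('D_1 (fun s : R => f (x + s *: v)) t = 'D_v f (x + t *: v)).
Proof.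
have E : (fun h : R => h^-1 *: (f (x + (h *: (1 : R) + t) *: v) - f (x + t *: v))) =
   (fun h : R => h^-1 *: (f (h *: v + (x + t *: v)) - f (x + t *: v))).
  apply/funext => h; congr (_ *: (f _ - _)).
  by rewrite [h *: 1]mulr1 scalerDl addrCA.
by split; rewrite /derivable /derive /= E.
Qed.

Lemma derive_translate f x v w :
  (derivable (fun z => f (z + w)) x v = derivable f (x + w) v) *
  ('D_v (fun z => f (z + w)) x = 'D_v f (x + w)).
Proof.
by split; rewrite /derivable /derive /=; under eq_fun do rewrite -addrA.
Qed.

Lemma MVT_line f x v (s : R) : (forall z, derivable f z v) -> 0 <= s ->
  exists2 t, 0 <= t <= s & f (x + s *: v) - f x = 'D_v f (x + t *: v) * s.
Proof.
move=> df s0.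
have dh t : derivable (fun s : R => f (x + s *: v)) t 1 by rewrite derive_line.
have [||t] := @MVT_segment R (fun s => f (x + s *: v))
    (fun t => 'D_v f (x + t *: v)) 0 s s0.
- by move=> t _; split => //; rewrite derive_line.
- apply: continuous_subspaceT => t.
  by apply: differentiable_continuous; apply/derivable1_diffP.
by rewrite in_itv /= scale0r addr0 subr0 => ts ->; exists t.
Qed.

Lemma cvg_mx m p (T : Type) (F : set_system T) (FF : Filter F)
    (A : T -> 'M[R]_(m, p)) (M : 'M[R]_(m, p)) :
  (forall i j, A t i j @[t --> F] --> M i j) -> A @ F --> M.
Proof.
move=> h; apply/cvgrPdist_lt => e e0; near=> t.
rewrite [X in X < _]/Num.norm /= mx_normrE; apply/bigmax_ltP; split => // -[i j] _.
rewrite !mxE /=; move: i j; near: t.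
apply: filter_forall => i; apply: filter_forall => j.
by have /cvgrPdist_lt := h i j; apply.
Unshelve. all: by end_near. Qed.

Lemma derive_grad f x v : differentiable f x -> 'D_v f x = dot (grad f x) v.
Proof.
move=> df; rewrite deriveE// {1}[v]row_sum_delta linear_sum /dot; apply: eq_bigr => i _.
by rewrite linearZ /= mxE /partial deriveE // mulrC.
Qed.

(** The second difference of [f] over a square of side [s] is symmetric in the
    two directions, while the mean value theorem, applied once in each
    direction, expresses it through one of the two mixed derivatives. *)
Lemma schwarz_quotient f (C2f : C2 f) x i j (s : R) : 0 <= s ->
  exists2 c, `|x - c| <= s *+ 2 &
   f (x + s *: delta_mx 0 i + s *: delta_mx 0 j) - f (x + s *: delta_mx 0 i) -
   f (x + s *: delta_mx 0 j) + f x = partial j (partial i f) c * s * s.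
Proof.
move=> s0; have [[df _] C1pf] := C2f.
set ei := delta_mx 0 i; set ej := delta_mx 0 j.
pose g z := f (z + s *: ej) - f z.
have dfj z : derivable (fun z => f (z + s *: ej)) z ei.
  by rewrite derive_translate; apply: diff_derivable.
have dfz z : derivable f z ei by apply: diff_derivable.
have dg z : derivable g z ei by apply: derivableB.
have [t /andP[t0 ts]] := MVT_line x dg s0.
rewrite {3}/g deriveB// derive_translate -/(partial i f (_ + _)) => E1.
have dpf z : derivable (partial i f) z ej.
  by apply: diff_derivable; have [] := C1pf i.
have [t' /andP[t'0 t's] E2] := MVT_line (x + t *: ei) dpf s0.
have dn k : `|delta_mx 0 k : 'rV[R]_n| <= 1.
  rewrite [X in X <= _]/Num.norm /= mx_normrE; apply/bigmax_leP; split => // -[a b] _.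
  by rewrite mxE /=; case: andP => _; rewrite ?normr1 ?normr0.
exists (x + t *: ei + t' *: ej).
  rewrite opprD addrA opprD addNKr -opprD normrN mulr2n.
  apply: (le_trans (ler_normD _ _)); rewrite !normrZ !ger0_norm//.
  by apply: lerD; rewrite -[leRHS]mulr1; apply: ler_pM => //; exact: dn.
have -> : f (x + s *: ei + s *: ej) - f (x + s *: ei) - f (x + s *: ej) + f x =
   g (x + s *: ei) - g x by rewrite /g; ring.
by rewrite E1 E2.
Qed.

(** Schwarz's theorem: both mixed derivatives are limits of the same second
    differences.  Continuity of [F] is assumed only on symmetric matrices, so
    limits of [F] along Hessians rest on this symmetry. *)
Lemma hess_sym f x : C2 f -> symmx (hess f x).
Proof.
move=> C2f; apply/matrixP => i j; rewrite !mxE.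
set A := partial j (partial i f); set B := partial i (partial j f).
have [_ C1p] := C2f.
have cA : continuous A by have [_] := C1p i; apply.
have cB : continuous B by have [_] := C1p j; apply.
apply/eqP; rewrite -subr_eq0 -normr_le0; apply/ler_addgt0Pr => e e0; rewrite add0r.
have e20 : 0 < e / 2 by rewrite divr_gt0.
have [d /= d0 dA] : \forall d \near 0^'+, forall c, `|x - c| <= d *+ 2 ->
    `|A x - A c| < e / 2 /\ `|B x - B c| < e / 2.
  have /cvgrPdist_lt /(_ _ e20) hA := cA x.
  have /cvgrPdist_lt /(_ _ e20) hB := cB x.
  have /nbhs_ballP[r /= r0 hr] :
      nbhs x [set c | `|A x - A c| < e / 2 /\ `|B x - B c| < e / 2].
    exact: filterI hA hB.
  exists (r / 2) => /=; first by rewrite divr_gt0.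
  move=> d /=; rewrite sub0r normrN => dr d0 c xc.
  apply: hr; rewrite -ball_normE /=; apply: (le_lt_trans xc).
  by move: dr; rewrite gtr0_norm// [d *+ 2]mulr2n; lra.
pose s := d / 2; have s0 : 0 < s by rewrite divr_gt0.
have /dA /(_ s0) {}dA : ball 0 d s.
  by rewrite -ball_normE /= sub0r normrN gtr0_norm// /s ltr_pdivrMr// ltr_pMr// ltr1n.
have [c xc Ec] := schwarz_quotient C2f x i j (ltW s0).
have [c' xc' Ec'] := schwarz_quotient C2f x j i (ltW s0).
have EE : A c = B c'.
  apply: (mulIf (lt0r_neq0 s0)); apply: (mulIf (lt0r_neq0 s0)).
  apply: etrans (esym Ec) _; apply: etrans _ Ec'.
  have -> : x + s *: delta_mx 0 i + s *: delta_mx 0 j =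
            x + s *: delta_mx 0 j + s *: delta_mx 0 i by exact: addrAC.
  by move: (f _) (f _) (f _) (f _) => a b a' b'; ring.
have [hA _] := dA _ xc; have [_ hB] := dA _ xc'.
have -> : A x - B x = (A x - A c) - (B x - B c').
  by rewrite EE opprB addrA subrK.
apply: (le_trans (ler_normB _ _)); rewrite (splitr e).
by apply: lerD; apply: ltW; [exact: hA|exact: hB].
Qed.

End Directional.

(** * Scalar products and the calculus of C^1 and C^2 functions *)
Section Dot.
Variables (R : realType) (n : nat).
Implicit Types (u v w : 'rV[R]_n).

Lemma dotC u v : dot u v = dot v u.
Proof. by apply: eq_bigr => i _; rewrite mulrC. Qed.

Lemma dotDl u v w : dot (u + v) w = dot u w + dot v w.
Proof. by rewrite -big_split; apply: eq_bigr => i _; rewrite mxE mulrDl. Qed.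

Lemma dotNl u w : dot (- u) w = - dot u w.
Proof. by rewrite -sumrN; apply: eq_bigr => i _; rewrite mxE mulNr. Qed.

Lemma dotZl a u w : dot (a *: u) w = a * dot u w.
Proof. by rewrite mulr_sumr; apply: eq_bigr => i _; rewrite mxE mulrA. Qed.

Lemma dotDr u v w : dot w (u + v) = dot w u + dot w v.
Proof. by rewrite dotC dotDl !(dotC w). Qed.

Lemma dotNr u w : dot w (- u) = - dot w u.
Proof. by rewrite dotC dotNl dotC. Qed.

Lemma dotZr a u w : dot w (a *: u) = a * dot w u.
Proof. by rewrite dotC dotZl dotC. Qed.

Lemma dot0l u : dot 0 u = 0.
Proof. by rewrite /dot big1 // => i _; rewrite mxE mul0r. Qed.

Lemma coord_le_norm u i : `|u 0 i| <= `|u|.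
Proof.
rewrite [leRHS]/Num.norm /= mx_normrE.
by apply/bigmax_geP; right => /=; exists (0, i).
Qed.

(** The norm on row vectors is the maximum norm; quadratic penalties are
    Euclidean because they have to be smooth.  This and [dot_le_norm] translate
    between the two. *)
Lemma normsq_le_dot u : `|u| ^+ 2 <= dot u u.
Proof.
have ge0 : 0 <= dot u u by apply: sumr_ge0 => i _; rewrite -expr2 sqr_ge0.
have uE : `|u| = mx_norm u by [].
have [u0|/mx_norm_neq0[[i j] /= E]] := eqVneq (mx_norm u) 0.
  by rewrite uE u0 expr0n.
rewrite uE E real_normK ?num_real// ord1 /dot (bigD1 j)//=.
by rewrite expr2 lerDl; apply: sumr_ge0 => k _; rewrite -expr2 sqr_ge0.
Qed.

Lemma dot_le_norm u v : `|dot u v| <= n%:R * (`|u| * `|v|).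
Proof.
apply: (le_trans (ler_norm_sum _ _ _)).
rewrite -[n in n%:R]card_ord mulr_natl -sumr_const.
by apply: ler_sum => i _; rewrite normrM ler_pM// coord_le_norm.
Qed.

Lemma cvg_coord (T : Type) (F : set_system T) (FF : Filter F)
    m (f : T -> 'M[R]_(m, n)) (a : 'M[R]_(m, n)) i j : f @ F --> a -> f t i j @[t --> F] --> a i j.
Proof.
move=> /cvgrPdist_lt fa; apply/cvgrPdist_lt => e e0.
apply: filterS (fa e e0) => t; apply: le_lt_trans.
rewrite [leRHS]/Num.norm /= mx_normrE; apply/bigmax_geP; right => /=.
by exists (i, j) => //=; rewrite !mxE.
Qed.

Lemma cvg_dot (T : Type) (F : set_system T) (FF : Filter F)
    (f g : T -> 'rV[R]_n) (a b : 'rV[R]_n) : f @ F --> a -> g @ F --> b ->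
  dot (f t) (g t) @[t --> F] --> dot a b.
Proof.
move=> fa gb; apply: cvg_big => [|i _]; first exact: add_continuous.
by apply: cvgM; apply: cvg_coord.
Qed.

End Dot.

Lemma dot_row_mx (R : realType) n (u v : 'rV[R]_n) (a b : R) :
  dot (row_mx u a%:M) (row_mx v b%:M) = dot u v + a * b.
Proof.
rewrite /dot big_split_ord /= big_ord1 !row_mxEr !mxE eqxx mulr1n; congr (_ + _).
by apply: eq_bigr => i _; rewrite !row_mxEl.
Qed.

Lemma addmxE (R : realType) m n (A B : 'M[R]_(m, n)) i j :
  (A + B) i j = A i j + B i j.
Proof. by rewrite mxE. Qed.

Lemma oppmxE (R : realType) m n (A : 'M[R]_(m, n)) i j : (- A) i j = - A i j.
Proof. by rewrite mxE. Qed.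

Section C1C2.
Variables (R : realType) (n : nat).
Implicit Types (f g : 'rV[R]_n -> R) (x v w : 'rV[R]_n).

Lemma C1_continuous f : C1 f -> continuous f.
Proof. by move=> [df _] x; apply: differentiable_continuous. Qed.

Lemma partialD f g x i : differentiable f x -> differentiable g x ->
  partial i (fun x => f x + g x) x = partial i f x + partial i g x.
Proof. by move=> df dg; rewrite /partial deriveD//; exact: diff_derivable. Qed.

Lemma partialM f g x i : differentiable f x -> differentiable g x ->
  partial i (fun x => f x * g x) x = f x * partial i g x + g x * partial i f x.
Proof. by move=> df dg; rewrite /partial deriveM//; exact: diff_derivable. Qed.

Lemma C1_cst (a : R) : C1 (fun _ : 'rV[R]_n => a).
Proof.
split=> [x|i]; first exact: differentiable_cst.
have -> : partial i (fun _ => a) = fun _ : 'rV[R]_n => 0.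
  by apply/funext => x; rewrite /partial derive_cst.
exact: cst_continuous.
Qed.

Lemma C1D f g : C1 f -> C1 g -> C1 (fun x => f x + g x).
Proof.
move=> [df cf] [dg cg]; split=> [x|i]; first exact: differentiableD.
have -> : partial i (fun x => f x + g x) = (fun x => partial i f x + partial i g x).
  by apply/funext => x; exact: partialD.
by move=> x; exact: cvgD (cf i x) (cg i x).
Qed.

Lemma C1M f g : C1 f -> C1 g -> C1 (fun x => f x * g x).
Proof.
move=> C1f C1g; have [df cf] := C1f; have [dg cg] := C1g.
split=> [x|i]; first exact: differentiableM.
have -> : partial i (fun x => f x * g x) =
    (fun x => f x * partial i g x + g x * partial i f x).
  by apply/funext => x; exact: partialM.
move=> x; exact: cvgD (cvgM (C1_continuous C1f (x := x)) (cg i x))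
                      (cvgM (C1_continuous C1g (x := x)) (cf i x)).
Qed.

Lemma C1_sum m (f : 'I_m -> 'rV[R]_n -> R) : (forall k, C1 (f k)) ->
  C1 (fun x => \sum_(k < m) f k x).
Proof.
move=> hf; elim: m f hf => [f _|m IH f hf].
  have -> : (fun x => \sum_(k < 0) f k x) = (fun _ => 0).
    by apply/funext => x; rewrite big_ord0.
  exact: C1_cst.
have -> : (fun x => \sum_(k < m.+1) f k x) =
   (fun x => f ord0 x + \sum_(k < m) f (lift ord0 k) x).
  by apply/funext => x; rewrite big_ord_recl.
by apply: C1D => //; apply: IH.
Qed.

Lemma partial_sum m (f : 'I_m -> 'rV[R]_n -> R) x i :
  (forall k, differentiable (f k) x) ->
  partial i (fun x => \sum_(k < m) f k x) x = \sum_(k < m) partial i (f k) x.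
Proof.
move=> df; rewrite /partial -derive_sum; last by move=> k; exact: diff_derivable.
by congr ('D_ _ _ _); apply/funext => y; rewrite fct_sumE.
Qed.

Lemma C1_dot m (f g : 'rV[R]_n -> 'rV[R]_m) : C1v f -> C1v g ->
  C1 (fun x => dot (f x) (g x)).
Proof. by move=> hf hg; apply: C1_sum => k; apply: C1M. Qed.

Lemma grad_dot m (f g : 'rV[R]_n -> 'rV[R]_m) x : C1v f -> C1v g ->
  grad (fun x => dot (f x) (g x)) x = f x *m Dmx g x + g x *m Dmx f x.
Proof.
move=> hf hg; apply/rowP => j; rewrite !mxE partial_sum; last first.
  by move=> k; apply: differentiableM; [have [] := hf k|have [] := hg k].
rewrite -big_split /=; apply: eq_bigr => k _; rewrite !mxE partialM//.
- by have [] := hf k.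
- by have [] := hg k.
Qed.

Lemma gradD f g x : C1 f -> C1 g ->
  grad (fun x => f x + g x) x = grad f x + grad g x.
Proof. by move=> [df _] [dg _]; apply/rowP => i; rewrite !mxE partialD. Qed.

Lemma gradN f x : C1 f -> grad (fun x => - f x) x = - grad f x.
Proof.
move=> [df _]; apply/rowP => i; rewrite !mxE /partial deriveN//.
exact: diff_derivable.
Qed.

Lemma C1N f : C1 f -> C1 (fun x => - f x).
Proof.
move=> C1f; have -> : (fun x => - f x) = (fun x => -1 * f x).
  by apply/funext => x; rewrite mulN1r.
by apply: C1M => //; exact: C1_cst.
Qed.

Lemma partialN f x i : C1 f -> partial i (fun x => - f x) x = - partial i f x.
Proof. by move=> /gradN => /(_ x)/rowP/(_ i); rewrite !mxE. Qed.

Lemma C2D f g : C2 f -> C2 g -> C2 (fun x => f x + g x).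
Proof.
move=> [C1f C2f] [C1g C2g]; split; first exact: C1D.
move=> i; have -> : partial i (fun x => f x + g x) =
    (fun x => partial i f x + partial i g x).
  by apply/funext => x; apply: partialD; [have [] := C1f|have [] := C1g].
exact: C1D.
Qed.

Lemma hessE f x i j : hess f x i j = partial i (partial j f) x.
Proof. by rewrite mxE. Qed.

Lemma hessD f g x : C2 f -> C2 g ->
  hess (fun x => f x + g x) x = hess f x + hess g x.
Proof.
move=> [[df _] C2f] [[dg _] C2g]; apply/matrixP => i j.
apply: etrans (hessE _ _ _ _) _; apply: etrans (esym (addmxE _ _ _ _)).
apply: etrans (esym (congr2 +%R (hessE f x i j) (hessE g x i j))).
have -> : partial j (fun x => f x + g x) = (fun x => partial j f x + partial j g x).
  by apply/funext => z; apply: partialD.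
by apply: partialD; [have [] := C2f j|have [] := C2g j].
Qed.

Lemma C2N f : C2 f -> C2 (fun x => - f x).
Proof.
move=> [C1f C2f]; split; first exact: C1N.
move=> i; have -> : partial i (fun x => - f x) = (fun x => - partial i f x).
  by apply/funext => x; apply: partialN.
exact: C1N.
Qed.

Lemma hessN f x : C2 f -> hess (fun x => - f x) x = - hess f x.
Proof.
move=> [C1f C2f]; apply/matrixP => i j.
apply: etrans (hessE _ _ _ _) _; apply: etrans (esym (oppmxE _ _ _)).
apply: etrans (esym (congr1 -%R (hessE f x i j))).
have -> : partial j (fun x => - f x) = (fun x => - partial j f x).
  by apply/funext => z; apply: partialN.
by apply: partialN.
Qed.

Lemma grad_continuous f : C1 f -> continuous (grad f).
Proof.
move=> [_ cf] x; apply: (cvg_mx (nbhs_filter x)) => i j; rewrite ord1.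
under eq_fun do rewrite mxE.
by rewrite mxE; exact: cf.
Qed.

Lemma C1v_continuous m (f : 'rV[R]_n -> 'rV[R]_m) : C1v f -> continuous f.
Proof.
move=> C1f x; apply: (cvg_mx (nbhs_filter x)) => i j; rewrite ord1.
exact: (C1_continuous (C1f j)).
Qed.

Lemma hess_continuous f : C2 f -> continuous (hess f).
Proof.
move=> [_ C2f] x; apply: (cvg_mx (nbhs_filter x)) => i j.
under eq_fun do rewrite mxE.
by rewrite mxE; have [_] := C2f j; exact.
Qed.

Lemma C1v_grad f : C2 f -> C1v (grad f).
Proof.
move=> [_ C2f] i; have -> : (fun x => grad f x 0 i) = partial i f.
  by apply/funext => x; rewrite mxE.
exact: C2f.
Qed.

Lemma Dmx_grad f x : C2 f -> Dmx (grad f) x = hess f x.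
Proof.
move=> C2f; rewrite -(hess_sym x C2f); apply/matrixP => i j; rewrite !mxE.
by congr (partial _ _ _); apply/funext => z; rewrite mxE.
Qed.

(** Continuity of the gradient makes the derivative at [x0] approximate all
    increments between two points near [x0], by the mean value theorem on the
    segment between them. *)
Lemma C1_strict_diff f x0 (e : R) : C1 f -> 0 < e ->
  exists2 d, 0 < d & forall x y, `|x - x0| < d -> `|y - x0| < d ->
    `|f x - f y - dot (grad f x0) (x - y)| <= e * `|x - y|.
Proof.
move=> C1f e0; have [df _] := C1f.
have e1 : 0 < e / n.+1%:R by rewrite divr_gt0.
have /cvgrPdist_lt /(_ _ e1) /nbhs_ballP[d /= d0 hd] := grad_continuous C1f (x := x0).
exists d => // x y xd yd.
have dv z : derivable f z (x - y) by apply: diff_derivable.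
have [t /andP[t0 t1]] := MVT_line y dv ler01.
rewrite scale1r [y + _]addrC subrK mulr1 derive_grad// => ->.
rewrite -dotNl -dotDl; apply: (le_trans (dot_le_norm _ _)); rewrite mulrA.
apply: ler_wpM2r => //.
set c := y + t *: (x - y).
have /hd/ltW hc : ball x0 d c.
  rewrite -ball_normE /= distrC.
  have -> : c - x0 = t *: (x - x0) + (1 - t) *: (y - x0).
    by apply/rowP => i; rewrite !mxE; ring.
  apply: (le_lt_trans (ler_normD _ _)); rewrite !normrZ !ger0_norm ?subr_ge0//.
  have [->|tn0] := eqVneq t 0; first by rewrite mul0r add0r subr0 mul1r.
  have : t * `|x - x0| < t * d by rewrite ltr_pM2l// lt0r tn0.
  have : (1 - t) * `|y - x0| <= (1 - t) * d by rewrite ler_wpM2l ?subr_ge0// ltW.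
  by lra.
rewrite distrC in hc; apply: (le_trans (ler_wpM2l (ler0n _ _) hc)).
by rewrite mulrCA ger_pMr// ler_pdivrMr// mul1r ler_nat.
Qed.
End C1C2.

(** * Quadratic functions and functions of the base variable *)
Section Quadratic.
Variable R : realType.

Lemma partial_coord n i j (x : 'rV[R]_n) :
  partial j (fun z : 'rV[R]_n => z 0 i) x = (j == i)%:R.
Proof.
rewrite /partial.
have -> : 'D_(delta_mx 0 j) (fun z : 'rV[R]_n => z 0 i) x =
    'd (fun z : 'rV[R]_n => z 0 i) x (delta_mx 0 j).
  by rewrite deriveE//; exact: differentiable_coord.
have lin : linear (fun z : 'rV[R]_n => z 0 i : R).
  by move=> a u w; rewrite !mxE.
pose L : {linear 'rV[R]_n -> R} := HB.pack (fun z : 'rV[R]_n => z 0 i : R)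
   (GRing.isLinear.Build _ _ _ _ (fun z : 'rV[R]_n => z 0 i : R) lin).
rewrite (_ : (fun z : 'rV[R]_n => z 0 i) = L)// diff_lin; last first.
  exact: coord_continuous.
by rewrite /= mxE eqxx eq_sym.
Qed.

Lemma C1_coord n i : C1 (fun z : 'rV[R]_n => z 0 i).
Proof.
split=> [x|j]; first exact: differentiable_coord.
have -> : partial j (fun z : 'rV[R]_n => z 0 i) = fun _ => (j == i)%:R.
  by apply/funext => x; exact: partial_coord.
exact: cst_continuous.
Qed.

Section Affine.
Variables (m n : nat) (b0 : 'rV[R]_n) (S : 'M[R]_(m, n)).

Let affineE i : (fun z : 'rV[R]_m => (b0 + z *m S) 0 i) =
  (fun z => b0 0 i + \sum_(k < m) z 0 k * S k i).
Proof. by apply/funext => z; rewrite !mxE. Qed.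

Let C1s i : C1 (fun z : 'rV[R]_m => \sum_(k < m) z 0 k * S k i).
Proof.
by apply: C1_sum => k; apply: C1M; [exact: C1_coord|exact: C1_cst].
Qed.

Lemma C1v_affine : C1v (fun z : 'rV[R]_m => b0 + z *m S).
Proof. by move=> i; rewrite affineE; apply: C1D; [exact: C1_cst|exact: C1s]. Qed.

Lemma Dmx_affine z : Dmx (fun z : 'rV[R]_m => b0 + z *m S) z = S^T.
Proof.
apply/matrixP => i j; rewrite [LHS]mxE [RHS]mxE affineE partialD; last 2 first.
- exact: differentiable_cst.
- by have [] := C1s i.
have dk k : differentiable (fun z : 'rV[R]_m => z 0 k * S k i) z.
  by apply: differentiableM; [exact: differentiable_coord|exact: differentiable_cst].
rewrite partial_sum // {1}/partial derive_cst add0r (bigD1 j)//= big1 ?addr0 => [|k kj];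
  rewrite partialM ?partial_coord; try exact: differentiable_coord;
  try exact: differentiable_cst; rewrite {1}/partial derive_cst mulr0 add0r.
  by rewrite eqxx mulr1.
by rewrite eq_sym (negbTE kj) mulr0.
Qed.

End Affine.

(** For symmetric [S] this is the quadratic function with gradient
    [b + z *m S] and Hessian [S]. *)
Definition quad n (b : 'rV[R]_n) (S : 'M[R]_n) (z : 'rV[R]_n) : R :=
  dot (b + z *m (2^-1 *: S)) z.

Section Quad.
Variables (n : nat) (b : 'rV[R]_n) (S : 'M[R]_n).
Hypothesis symS : symmx S.

Let quadE : quad b S = fun z => dot (b + z *m (2^-1 *: S)) (0 + z *m 1%:M).
Proof. by apply/funext => z; rewrite add0r mulmx1. Qed.

Let C1_quad : C1 (quad b S).
Proof. rewrite quadE; exact: C1_dot (C1v_affine _ _) (C1v_affine _ _). Qed.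

Lemma grad_quad z : grad (quad b S) z = b + z *m S.
Proof.
rewrite quadE (grad_dot z (C1v_affine b _) (C1v_affine 0 _)) !Dmx_affine.
have -> : (2^-1 *: S)^T = 2^-1 *: S by rewrite linearZ /= symS.
rewrite add0r trmx1 !mulmx1 -addrA -mulmxDr -scalerDl.
by rewrite (_ : 2^-1 + 2^-1 = 1) ?scale1r//; lra.
Qed.

Let partial_quad i : partial i (quad b S) = fun z => (b + z *m S) 0 i.
Proof. by apply/funext => z; rewrite -grad_quad mxE. Qed.

Lemma C2_quad : C2 (quad b S).
Proof. by split=> // i; rewrite partial_quad; exact: C1v_affine. Qed.

Lemma hess_quad z : hess (quad b S) z = S.
Proof.
apply/matrixP => i j; rewrite hessE partial_quad.
have /matrixP/(_ j i) := Dmx_affine b S z.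
by rewrite !mxE => ->.
Qed.

End Quad.

Lemma quad_scalar n (k : R) (x0 x : 'rV[R]_n) : quad (- k *: x0) k%:M x =
  k / 2 * dot (x - x0) (x - x0) - k / 2 * dot x0 x0.
Proof.
rewrite /quad scale_scalar_mx mul_mx_scalar.
by rewrite !(dotDl, dotDr, dotNl, dotNr, dotZl, dotZr) (dotC x0 x); field.
Qed.

Section Xpart.
Variable N : nat.
Implicit Types (f : 'rV[R]_N -> R) (z v : 'rV[R]_(N + 1)).

Lemma derive_xpart f z v :
  'D_v (fun z => f (xpart z)) z = 'D_(xpart v) f (xpart z).
Proof.
have E h : xpart (h *: v + z) = h *: xpart v + xpart z.
  by apply/rowP => i; rewrite !mxE.
by rewrite /derive /=; under eq_fun do rewrite E.
Qed.

Lemma xpart_delta_l (j : 'I_N) :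
  xpart (delta_mx 0 (lshift 1 j) : 'rV[R]_(N + 1)) = delta_mx 0 j.
Proof.
by apply/rowP => i; rewrite !mxE/= eq_lshift.
Qed.

Lemma xpart_delta_r (j : 'I_1) :
  xpart (delta_mx 0 (rshift N j) : 'rV[R]_(N + 1)) = 0.
Proof.
by apply/rowP => i; rewrite !mxE/= eq_lrshift.
Qed.

Lemma partial_xpart_l f z j :
  partial (lshift 1 j) (fun z => f (xpart z)) z = partial j f (xpart z).
Proof. by rewrite /partial derive_xpart xpart_delta_l. Qed.

Lemma partial_xpart_r f z j :
  partial (rshift N j) (fun z => f (xpart z)) z = 0.
Proof. by rewrite /partial derive_xpart xpart_delta_r derive0. Qed.

Lemma grad_xpart f z :
  grad (fun z => f (xpart z)) z = row_mx (grad f (xpart z)) 0.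
Proof.
apply/rowP => i; rewrite mxE; case: (split_ordP i) => j ->.
  by rewrite row_mxEl partial_xpart_l mxE.
by rewrite row_mxEr partial_xpart_r mxE.
Qed.

Lemma xpart_continuous : continuous (@xpart R N).
Proof.
move=> z; apply: (cvg_mx (nbhs_filter z)) => i j.
have E (w : 'rV[R]_(N + 1)) : xpart w i j = w i (lshift 1 j) by rewrite mxE.
by rewrite E; under eq_fun do rewrite E; exact: coord_continuous.
Qed.

Lemma ypart_continuous : continuous (@ypart R N).
Proof.
have -> : @ypart R N = fun z => z 0 (rshift N 0).
  by apply/funext => z; rewrite /ypart mxE.
by move=> z; exact: coord_continuous.
Qed.

Lemma C1_xpart f : C1 f -> C1 (fun z : 'rV[R]_(N + 1) => f (xpart z)).
Proof.
move=> [df cf]; split=> [z|i].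
  apply: differentiable_comp; last exact: df.
  exact: differentiable_lsubmx.
case: (split_ordP i) => j ->.
  have -> : partial (lshift 1 j) (fun z => f (xpart z)) =
      (fun z => partial j f (xpart z)).
    by apply/funext => z; rewrite partial_xpart_l.
  move=> z; apply: continuous_comp; [exact: xpart_continuous|exact: cf].
have -> : partial (rshift N j) (fun z => f (xpart z)) = fun _ => 0.
  by apply/funext => z; rewrite partial_xpart_r.
exact: cst_continuous.
Qed.

Lemma C2_xpart f : C2 f -> C2 (fun z : 'rV[R]_(N + 1) => f (xpart z)).
Proof.
move=> [C1f C2f]; split; first exact: C1_xpart.
move=> i; case: (split_ordP i) => j ->.
  have -> : partial (lshift 1 j) (fun z => f (xpart z)) =
      (fun z => partial j f (xpart z)).
    by apply/funext => z; rewrite partial_xpart_l.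
  exact: C1_xpart.
have -> : partial (rshift N j) (fun z => f (xpart z)) = fun _ => 0.
  by apply/funext => z; rewrite partial_xpart_r.
exact: C1_cst.
Qed.

Lemma hess_xpart f z : C2 f ->
  hess (fun z => f (xpart z)) z = block_mx (hess f (xpart z)) 0 0 0.
Proof.
move=> C2f; apply/matrixP => i j; rewrite hessE.
case: (split_ordP j) => j' ->; last first.
  have -> : partial (rshift N j') (fun z => f (xpart z)) = fun _ => 0.
    by apply/funext => y; rewrite partial_xpart_r.
  rewrite /partial derive_cst.
  by case: (split_ordP i) => i' ->; [rewrite block_mxEur|rewrite block_mxEdr];
    rewrite [RHS]mxE.
have -> : partial (lshift 1 j') (fun z => f (xpart z)) =
    (fun z => partial j' f (xpart z)).
  by apply/funext => y; rewrite partial_xpart_l.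
case: (split_ordP i) => i' ->.
  by rewrite partial_xpart_l block_mxEul hessE.
by rewrite partial_xpart_r block_mxEdl mxE.
Qed.

Lemma row_mx_xypart z : z = row_mx (xpart z) (ypart z)%:M.
Proof.
apply/rowP => i; case: (split_ordP i) => j ->.
  by rewrite row_mxEl mxE.
by rewrite row_mxEr ord1 /ypart !mxE eqxx mulr1n.
Qed.

Lemma xpart_row (x : 'rV[R]_N) (y : R) : xpart (row_mx x y%:M) = x.
Proof. by rewrite /xpart row_mxKl. Qed.

Lemma ypart_row (x : 'rV[R]_N) (y : R) : ypart (row_mx x y%:M) = y.
Proof. by rewrite /ypart row_mxKr mxE eqxx mulr1n. Qed.

End Xpart.
End Quadratic.

(** * Semicontinuous envelopes *)
Lemma near_mxS (R : realType) m n (x : 'M[R]_(m, n)) (P Q : set 'M[R]_(m, n)) :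
  P `<=` Q -> (\forall w \near x, P w) -> \forall w \near x, Q w.
Proof. by move=> PQ; exact: filterS. Qed.

Lemma near_mxW (R : realType) m n (x : 'M[R]_(m, n)) (P : set 'M[R]_(m, n)) :
  (forall w, P w) -> \forall w \near x, P w.
Proof. by move=> Pw; near=> w; exact: Pw. Unshelve. all: by end_near. Qed.

Section Envelope.
Variables (R : realType) (n : nat) (K : set 'rV[R]_n).
Implicit Types (u : 'rV[R]_n -> R) (z : 'rV[R]_n).

Lemma limf_esup_within_ge u z : K z ->
  ((u z)%:E <= limf_esup (EFin \o u) (within K (nbhs z)))%E.
Proof.
move=> Kz; apply: le_ereal_inf_tmp => _ [V /= VF <-]; apply: ereal_sup_ubound.
by exists z => //; apply: (nbhs_singleton VF).
Qed.

Lemma limf_esup_within_le u z t :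
  (\forall w \near z, K w -> u w <= t) ->
  (limf_esup (EFin \o u) (within K (nbhs z)) <= t%:E)%E.
Proof.
move=> ut; apply: (@le_trans _ _ (ereal_sup ((EFin \o u) @` [set w | u w <= t]))).
  by apply: ereal_inf_lbound; exists [set w | u w <= t].
by apply: ge_ereal_sup => _ [w /= wt <-]; rewrite lee_fin.
Qed.

Lemma usc_envE u z t : K z -> (\forall w \near z, K w -> u w <= t) ->
  limf_esup (EFin \o u) (within K (nbhs z)) = (usc_env K u z)%:E.
Proof.
move=> Kz ut; rewrite fineK// fin_real// (lt_le_trans _ (limf_esup_within_ge u Kz)) ?ltNyr//.
by rewrite (le_lt_trans (limf_esup_within_le ut)) ?ltry.
Qed.

(** Together with [usc_env_lt] this characterises the envelope: it is the
    infimum of the real upper bounds of [u] near [z] within [K]. *)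
Lemma usc_env_le u z t : K z -> (\forall w \near z, K w -> u w <= t) ->
  usc_env K u z <= t.
Proof.
move=> Kz ut; rewrite -lee_fin -(usc_envE Kz ut); exact: limf_esup_within_le.
Qed.

Section Bounded.
Variables (u : 'rV[R]_n -> R) (C : R).
Hypothesis uC : forall w, K w -> u w <= C.

Let uC' z : \forall w \near z, K w -> u w <= C.
Proof. exact: near_mxW. Qed.

Lemma usc_env_ge z : K z -> u z <= usc_env K u z.
Proof.
by move=> Kz; rewrite -lee_fin -(usc_envE Kz (uC' z)); exact: limf_esup_within_ge.
Qed.

Lemma usc_env_lt z t : K z -> usc_env K u z < t ->
  \forall w \near z, K w -> u w < t.
Proof.
move=> Kz; rewrite -lte_fin -(usc_envE Kz (uC' z)) => /ereal_inf_lt[_ [V /= VF <-] Vt].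
move: (VF : \forall w \near z, K w -> V w); apply: near_mxS => w KV Kw.
rewrite -lte_fin; apply: le_lt_trans Vt; apply: ereal_sup_ubound.
by exists w => //; exact: KV.
Qed.

Lemma usc_env_usc z t : K z -> usc_env K u z < t ->
  \forall w \near z, K w -> usc_env K u w < t.
Proof.
move=> Kz zt; have [zt' t't] := midf_lt zt; set t' := (_ / _) in zt' t't.
have /near_join := usc_env_lt Kz zt'; apply: near_mxS => w wt' Kw.
apply: le_lt_trans t't; apply: usc_env_le => //.
by move: wt'; apply: near_mxS => w' h /h /ltW.
Qed.

End Bounded.

Lemma usc_env_id u z : K z ->
  (forall t, u z < t -> \forall w \near z, K w -> u w < t) ->
  usc_env K u z = u z.
Proof.
move=> Kz uscu.
have near_le t : u z < t -> \forall w \near z, K w -> u w <= t.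
  by move=> /uscu; apply: near_mxS => w h /h /ltW.
apply/eqP; rewrite eq_le; apply/andP; split.
  by apply/ler_addgt0Pr => e e0; apply: usc_env_le => //; apply: near_le; rewrite ltrDl.
have h : u z < u z + 1 by rewrite ltrDl.
by rewrite -lee_fin -(usc_envE Kz (near_le _ h)); exact: limf_esup_within_ge.
Qed.

Lemma lsc_envE u z : lsc_env K u z = - usc_env K (fun w => - u w) z.
Proof. by rewrite /lsc_env /limf_einf fineN. Qed.

End Envelope.

Section UscMax.
Variables (R : realType) (T : topologicalType).

(** If there were no maximum point, every point of [K] would have a
    neighbourhood on which [f] stays below a value that [f] takes elsewhere on
    [K].  Along the filter of the sets where [f] is at least a given value of
    [f] these neighbourhoods cover the compact set [K], which produces a point
    with value below itself. *)
Lemma usc_attains_max (K : set T) (f : T -> R) : compact K -> K !=set0 ->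
  (forall x t, K x -> f x < t -> \forall y \near x, K y -> f y < t) ->
  exists2 x, K x & forall y, K y -> f y <= f x.
Proof.
move=> /compact_near_coveringP cK [k0 Kk0] uscf; apply: contrapT => nomax.
have larger x : K x -> exists2 y, K y & f x < f y.
  move=> Kx; apply: contrapT => h; apply: nomax; exists x => // y Ky.
  by rewrite leNgt; apply/negP => xy; apply: h; exists y.
pose F := filter_from K (fun y0 => [set y | K y /\ f y0 <= f y]).
have FF : ProperFilter F.
  apply: filter_from_proper => [|y Ky]; last by exists y.
  apply: filter_from_filter; first by exists k0.
  move=> y1 y2 Ky1 Ky2; have [y12|/ltW y21] := leP (f y1) (f y2).
    by exists y2 => // y [Ky y2y]; split; split=> //; apply: le_trans y2y.
  by exists y1 => // y [Ky y1y]; split; split=> //; apply: le_trans y1y.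
have [y Ky h] : \near F, K `<=` (fun x => K x -> f x < f F).
  apply: cK => x Kx; have [y Ky xy] := larger _ Kx.
  exists ([set x' | K x' -> f x' < f y], [set y' | K y' /\ f y <= f y']).
    by split; [exact: uscf|exists y].
  by move=> [x' y'] /= [xlt [_ yy']] /xlt /lt_le_trans; apply.
by have := h y (conj Ky (lexx _)) y Ky Ky; rewrite ltxx.
Qed.

End UscMax.

(** * Half-relaxed limits over a shrinking family of sets *)
Section RelaxedLimit.
Variables (R : realType) (N : nat).
Variables (D : set 'rV[R]_N) (K : R -> set 'rV[R]_(N + 1)).
Implicit Types (x : 'rV[R]_N) (z : 'rV[R]_(N + 1)).
Implicit Types (P Q : R -> 'rV[R]_(N + 1) -> Prop).

(** The analogue of a neighbourhood filter for the points of the sets [K e]: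
    small [e], and base point close to [x]. *)
Definition near_thin x P := exists2 d : R, 0 < d &
  forall e z, 0 < e < d -> K e z -> `|xpart z - x| < d -> P e z.

Lemma near_thinS x P Q : (forall e z, K e z -> P e z -> Q e z) ->
  near_thin x P -> near_thin x Q.
Proof. by move=> PQ [d d0 h]; exists d => // e z ed Kz zx; apply/PQ/h. Qed.

Lemma near_thinI x P Q : near_thin x P -> near_thin x Q ->
  near_thin x (fun e z => P e z /\ Q e z).
Proof.
move=> [d d0 hP] [d' d'0 hQ]; exists (Num.min d d'); first by rewrite lt_min d0.
move=> e z; rewrite !lt_min => /and3P[e0 ed ed'] Kz /andP[zd zd'].
by split; [apply: hP|apply: hQ] => //; rewrite e0.
Qed.

Lemma near_thin_join x P : near_thin x P ->
  \forall x' \near x, near_thin x' P.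
Proof.
move=> [d d0 h]; have d20 : 0 < d / 2 by rewrite divr_gt0.
apply/nbhs_ballP; exists (d / 2) => //= x'; rewrite -ball_normE /= distrC => xx'.
exists (d / 2) => // e z /andP[e0 ed] Kz zx; apply: h => //.
  by rewrite e0; apply: lt_trans ed _; rewrite ltr_pdivrMr// ltr_pMr// ltr1n.
have -> : xpart z - x = (xpart z - x') + (x' - x) by rewrite addrA subrK.
apply: le_lt_trans (ler_normD _ _) _; rewrite (splitr d).
exact: ltrD.
Qed.

Lemma near_thin_xpart x (A : set 'rV[R]_N) : (\forall x' \near x, A x') ->
  near_thin x (fun _ z => A (xpart z)).
Proof.
move=> /nbhs_ballP[d /= d0 h]; exists d => // e z _ _ zx; apply: h.
by rewrite -ball_normE /= distrC.
Qed.

(** Compactness of the base makes a property that holds locally, near each base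
    point and for small [e], hold on all of [K e] for small [e]. *)
Lemma near_thin_compact P : compact D ->
  (forall x, D x -> near_thin x P) ->
  exists2 d : R, 0 < d &
    forall e z, 0 < e < d -> K e z -> D (xpart z) -> P e z.
Proof.
move=> /compact_near_coveringP cD DP.
have : \forall e \near 0^'+, D `<=`
    (fun x => forall z, K e z -> xpart z = x -> P e z).
  apply: cD => x Dx; have [d d0 h] := DP x Dx.
  exists (ball x d, [set e | 0 < e < d]).
    split; first exact: nbhsx_ballx.
    exists d => // e /=; rewrite sub0r normrN => ed e0 /=.
    by rewrite e0; move: ed; rewrite gtr0_norm.
  move=> [x' e] /= [xx' ed] z Kz zx'; apply: h => //.
  by rewrite zx' distrC; move: xx'; rewrite -ball_normE.
move=> [d /= d0 h]; exists d => // e z /andP[e0 ed] Kz Dz.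
by apply: (h e _ e0 (xpart z)) => //=; rewrite sub0r normrN gtr0_norm.
Qed.

Hypothesis thin_ne : forall x (d : R), D x -> 0 < d -> exists (e : R) z,
  [/\ 0 < e < d, K e z & `|xpart z - x| < d].

Lemma near_thin_ex x P : D x -> near_thin x P -> exists e z, K e z /\ P e z.
Proof.
move=> Dx [d d0 h]; have [e [z [ed Kz zx]]] := thin_ne Dx d0.
by exists e, z; split => //; exact: h.
Qed.

Definition relaxed_limsup (u : R -> 'rV[R]_(N + 1) -> R) x : R :=
  inf [set t | near_thin x (fun e z => u e z <= t)].

Section Bounded.
Variables (u : R -> 'rV[R]_(N + 1) -> R) (C e1 : R).
Hypothesis e1_gt0 : 0 < e1.
Hypothesis u_bounded : forall (e : R) z, 0 < e < e1 -> K e z -> `|u e z| <= C.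
Local Notation v := (relaxed_limsup u).

Lemma near_thin_bounded x : near_thin x (fun e z => `|u e z| <= C).
Proof. by exists e1 => // e z ed Kz _; exact: u_bounded. Qed.

Let lb x t : D x -> near_thin x (fun e z => u e z <= t) -> - C <= t.
Proof.
move=> Dx ut; have [e [z [_ [uC]]]] := near_thin_ex Dx
  (near_thinI (near_thin_bounded x) ut).
by apply: le_trans; move: uC; rewrite ler_norml => /andP[].
Qed.

Let C_in x : near_thin x (fun e z => u e z <= C).
Proof.
by apply: near_thinS (near_thin_bounded x) => e z _; rewrite ler_norml => /andP[].
Qed.

Lemma relaxed_limsup_le x t : D x -> near_thin x (fun e z => u e z <= t) ->
  v x <= t.
Proof.
by move=> Dx ut; apply: ge_inf => //; exists (- C) => s; exact: lb.
Qed.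

Lemma relaxed_limsup_lt x t : v x < t ->
  near_thin x (fun e z => u e z < t).
Proof.
have ne : [set t | near_thin x (fun e z => u e z <= t)] !=set0.
  by exists C; exact: C_in.
move=> /(inf_lt ne)[s us st]; apply: near_thinS us => e z _ /le_lt_trans; exact.
Qed.

Lemma relaxed_limsup_bounded x : D x -> `|v x| <= C.
Proof.
move=> Dx; rewrite ler_norml relaxed_limsup_le// andbT.
by apply: lb_le_inf => [|t]; [exists C; exact: C_in|exact: lb].
Qed.

Lemma relaxed_limsup_usc x t : D x -> v x < t ->
  \forall y \near x, D y -> v y < t.
Proof.
move=> Dx vt; have [vt' t't] := midf_lt vt; set t' := (_ / _) in vt' t't.
have /near_thin_join := relaxed_limsup_lt vt'; apply: near_mxS => y yt' Dy.
apply: le_lt_trans t't; apply: relaxed_limsup_le => //.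
by apply: near_thinS yt' => e z _ /ltW.
Qed.

Lemma relaxed_limsup_env x : D x -> usc_env D v x = v x.
Proof. by move=> Dx; apply: usc_env_id => // t; exact: relaxed_limsup_usc. Qed.

(** The envelope of [u e] at [z] only sees points of [K e] whose base point is
    close to that of [z], so the upper bound on [u e] is inherited. *)
Lemma relaxed_limsup_lt_env x t : v x < t ->
  near_thin x (fun e z => usc_env (K e) (u e) z < t).
Proof.
move=> vt; have [vt' t't] := midf_lt vt; set t' := (_ / _) in vt' t't.
have [d d0 h] := relaxed_limsup_lt vt'; exists d => // e z ed Kz zx.
apply: le_lt_trans t't; apply: usc_env_le => //.
have /nbhs_ballP[r /= r0 hr] : \forall y \near xpart z, `|y - x| < d.
  apply/nbhs_ballP; exists (d - `|xpart z - x|); first by rewrite /= subr_gt0.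
  move=> y; rewrite -ball_normE /= => zy.
  have -> : y - x = (xpart z - x) - (xpart z - y) by rewrite opprB [RHS]addrC subrKA.
  by apply: le_lt_trans (ler_normB _ _) _; rewrite -ltrBrDl.
have := @xpart_continuous R N z (ball (xpart z) r) (nbhsx_ballx _ _ r0).
apply: near_mxS => w /hr wx Kw; exact/ltW/h.
Qed.

End Bounded.
End RelaxedLimit.

(** * Maximum points of the penalised difference *)
Section PenalisedMaxima.
Variables (R : realType) (N : nat).
Variables (D : set 'rV[R]_N) (K : R -> set 'rV[R]_(N + 1)).
Hypothesis thin_ne : forall x (d : R), D x -> 0 < d -> exists (e : R) z,
  [/\ 0 < e < d, K e z & `|xpart z - x| < d].
Variables (u : R -> 'rV[R]_(N + 1) -> R) (C e1 : R).
Hypothesis e1_gt0 : 0 < e1.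
Hypothesis u_bounded : forall (e : R) z, 0 < e < e1 -> K e z -> `|u e z| <= C.
Hypothesis compD : compact D.
Hypothesis compK : forall e : R, 0 < e < e1 -> compact (K e).
Hypothesis xpartK : forall (e : R) z, 0 < e < e1 -> K e z -> D (xpart z).
Local Notation v := (relaxed_limsup K u).
Local Notation env e := (usc_env (K e) (u e)).

Lemma usc_sub_continuous e (E : set 'rV[R]_N)
    (f : 'rV[R]_(N + 1) * 'rV[R]_N -> R) : 0 < e < e1 ->
  continuous f -> forall t s, (K e `*` E) t -> env e t.1 - f t < s ->
  \forall t' \near t, (K e `*` E) t' -> env e t'.1 - f t' < s.
Proof.
move=> ee cf t s [Kt _] ts; pose h := (s - (env e t.1 - f t)) / 2.
have h0 : 0 < h by rewrite divr_gt0// subr_gt0.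
have uC w : K e w -> u e w <= C.
  by move=> /(u_bounded ee); rewrite ler_norml => /andP[].
have et : env e t.1 < env e t.1 + h by rewrite ltrDl.
have A := @cvg_fst _ _ (nbhs t.1) (nbhs t.2) _ _ (usc_env_usc uC Kt et).
have B := @cvgr_gt _ _ _ _ _ _ (cf t) (f t - h) ltac:(by rewrite gtrBl).
have AB : \forall t' \near t,
    (K e t'.1 -> env e t'.1 < env e t.1 + h) /\ f t - h < f t'.
  near=> t'; split; near: t'; [exact: A|exact: B].
near=> t' => -[Kt' _].
have [/(_ Kt') a b] : (K e t'.1 -> env e t'.1 < env e t.1 + h) /\ f t - h < f t'.
  by near: t'.
have hE : s = env e t.1 - f t + h + h by rewrite /h; field.
by rewrite hE; lra.
Unshelve. all: by end_near. Qed.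

Variables (phi : 'rV[R]_N -> R) (k : R) (x0 : 'rV[R]_N).
Variable H : R -> 'rV[R]_N -> 'rV[R]_(N + 1) -> R.
Hypothesis phi_cont : continuous phi.
Hypothesis k_gt0 : 0 < k.
Hypothesis Dx0 : D x0.
Hypothesis strict_max : forall x, D x ->
  v x - phi x <= v x0 - phi x0 - k / 2 * dot (x - x0) (x - x0).
Hypothesis H_cont : forall e,
  continuous (fun t : 'rV[R]_(N + 1) * 'rV[R]_N => H e t.2 t.1).
Hypothesis H_small : forall d : R, 0 < d -> exists2 d' : R, 0 < d' &
  forall (e : R) z xi, 0 < e < d' -> K e z -> D xi -> `|H e xi z| <= d.

Definition penalised e xi z :=
  phi (xpart z) + k / 2 * dot (xpart z - xi) (xpart z - xi) + H e xi z.

(** Along points where [u e] almost attains [v x0] the penalised difference is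
    almost [v x0 - phi x0].  Globally it is at most that value, up to a small
    error, minus the two quadratic terms: the one from the strict maximum of
    [v - phi] and the penalty.  So at a maximum point both quadratic terms are
    small, and nothing is lost in the value of the envelope. *)
Lemma penalised_maxima (d : R) : 0 < d -> exists (e : R) z xi,
  [/\ 0 < e < d, K e z, D xi &
   [/\ `|xpart z - x0| < d, `|xi - x0| < d, `|env e z - v x0| < d &
    forall w eta, K e w -> D eta ->
      env e w - penalised e eta w <= env e z - penalised e xi z]].
Proof.
move=> d0.
have dotcont : continuous (fun x : 'rV[R]_N => dot (x - x0) (x - x0)).
  move=> x; apply: (cvg_dot (nbhs_filter x));
    by apply: (@cvgB _ _ _ _ (nbhs_filter x)); [exact: cvg_id|exact: cvg_cst].
(* radius on which the upper bound near x0 and the continuity of phi give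
   precision d *)
have vd : v x0 < v x0 + d by rewrite ltrDl.
have [d4 d40 h4] := relaxed_limsup_lt_env e1_gt0 u_bounded vd.
have d20 : 0 < d / 2 by rewrite divr_gt0.
have /cvgrPdist_lt/(_ _ d20)/nbhs_ballP[d5 /= d50 h5] := phi_cont (x := x0).
pose r := Num.min d (Num.min d4 d5).
have r0 : 0 < r by rewrite !lt_min d0 d40.
(* Five errors of size at most [del] accumulate below; [5 * del] has to stay
   below [k / 2 * (r / 2) ^+ 2], and [4 * del] below [d / 2]. *)
pose del := Num.min (k * r ^+ 2 / 40) (d / 16).
have del0 : 0 < del by rewrite lt_min !divr_gt0// mulr_gt0// exprn_gt0.
have [d1 d10 h1] : exists2 d1 : R, 0 < d1 & forall (e : R) z, 0 < e < d1 -> K e z ->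
    D (xpart z) -> env e z - phi (xpart z) <
    v x0 - phi x0 - k / 2 * dot (xpart z - x0) (xpart z - x0) + del.
  apply: near_thin_compact => // x Dx.
  have del20 : 0 < del / 2 by rewrite divr_gt0.
  have vx : v x < v x + del / 2 by rewrite ltrDl.
  have cpsi : continuous (fun x => phi x - k / 2 * dot (x - x0) (x - x0)).
    move=> y; apply: (@cvgB _ _ _ _ (nbhs_filter y)); first exact: phi_cont.
    by apply: (@cvgM _ _ _ (nbhs_filter y)); [exact: cvg_cst|exact: dotcont].
  have /cvgrPdist_lt/(_ _ del20) cx := cpsi x.
  have := near_thinI (relaxed_limsup_lt_env e1_gt0 u_bounded vx)
    (near_thin_xpart K cx).
  apply: near_thinS => e z Kz [vz] /=; rewrite ltr_distl => /andP[_ c].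
  have := strict_max Dx; lra.
have [d2 d20' h2] := H_small del0.
have /cvgrPdist_lt/(_ _ del0)/nbhs_ballP[d3 /= d30 h3] := phi_cont (x := x0).
have [e [z' [ee Kz' zx' uz']]] : exists (e : R) z',
    [/\ 0 < e < Num.min d (Num.min d1 (Num.min d2 (Num.min d4 e1))), K e z',
    `|xpart z' - x0| < d3 & v x0 - del < u e z'].
  apply: contrapT => no.
  have : v x0 <= v x0 - del.
    apply: (relaxed_limsup_le thin_ne e1_gt0 u_bounded Dx0).
    exists (Num.min d3 (Num.min d (Num.min d1 (Num.min d2 (Num.min d4 e1))))).
      by rewrite !lt_min d30 d0 d10 d20' d40.
    move=> e z; rewrite !lt_min => /andP[e0 /andP[ed3 es]] Kz /andP[zx _].
    rewrite leNgt; apply/negP => uz; apply: no; exists e, z.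
    by split => //; rewrite !lt_min e0.
  by rewrite lerBrDl gerDr leNgt del0.
move: (ee); rewrite !lt_min => /and4P[e0 ed ed1 /and3P[ed2 ed4 ee1]].
have e01 : 0 < e < e1 by rewrite e0.
have [[z xi] [/= Kz Dxi] mx] : exists2 t, (K e `*` D) t & forall t',
   (K e `*` D) t' -> env e t'.1 - penalised e t'.2 t'.1 <=
                     env e t.1 - penalised e t.2 t.1.
  apply: (@usc_attains_max _ _ (K e `*` D)
    (fun t => env e t.1 - penalised e t.2 t.1)).
  - by apply: compact_setX => //; exact: compK.
  - by exists (z', x0).
  apply: (@usc_sub_continuous e D (fun t => penalised e t.2 t.1)) => //.
  move=> t; have cx : xpart t'.1 @[t' --> t] --> xpart t.1.
    by apply: continuous_comp; [exact: cvg_fst|exact: xpart_continuous].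
  have cd : xpart t'.1 - t'.2 @[t' --> t] --> xpart t.1 - t.2.
    by apply: cvgB => //; exact: cvg_snd.
  apply: cvgD; last exact: H_cont.
  apply: cvgD; first by apply: continuous_comp; [exact: cx|exact: phi_cont].
  by apply: cvgM; [exact: cvg_cst|exact: (@cvg_dot _ _ _ _ (nbhs_filter t))].
have Dz := xpartK e01 Kz; have Dz' := xpartK e01 Kz'.
have e0d1 : 0 < e < d1 by rewrite e0.
have e0d2 : 0 < e < d2 by rewrite e0.
have := mx (z', xpart z') (conj Kz' Dz').
rewrite /= /penalised subrr dot0l mulr0 addr0.
have := h1 _ _ e0d1 Kz Dz.
have := h2 _ _ _ e0d2 Kz Dxi; rewrite ler_norml => /andP[H1 H2].
have := h2 _ _ _ e0d2 Kz' Dz'; rewrite ler_norml => /andP[H1' H2'].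
have uC w : K e w -> u e w <= C.
  by move=> /(u_bounded e01); rewrite ler_norml => /andP[].
have := usc_env_ge uC Kz'.
have : `|phi x0 - phi (xpart z')| < del by apply: h3; rewrite -ball_normE /= distrC.
rewrite ltr_distl => /andP[p1 p2] uz'2 ub lb.
have nx := normsq_le_dot (xpart z - x0).
have nxi := normsq_le_dot (xpart z - xi).
set n1 := `|xpart z - x0| in nx; set n2 := `|xpart z - xi| in nxi.
set q1 := dot _ _ in nx ub; set q2 := dot _ _ in nxi lb.
have delr : del <= k * r ^+ 2 / 40 by rewrite ge_min lexx.
have deld : del <= d / 16 by rewrite ge_min lexx orbT.
have q1ge : 0 <= q1 by apply: le_trans nx; rewrite sqr_ge0.
have q2ge : 0 <= q2 by apply: le_trans nxi; rewrite sqr_ge0.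
have small q n : 0 <= n -> n ^+ 2 <= q -> k / 2 * q < 5 * del -> n < r / 2.
  move=> n0 nq kq; rewrite ltNge; apply/negP => rn.
  have : k * (r / 2) ^+ 2 <= k * q.
    rewrite ler_pM2l//; apply: le_trans nq.
    by rewrite ler_pXn2r// nnegrE// ltW// divr_gt0.
  have -> : k * (r / 2) ^+ 2 = k * r ^+ 2 / 4 by field.
  by clear ub lb p1 p2 uz' uz'2 H1 H2 H1' H2' => ?; lra.
have kq1 : 0 <= k / 2 * q1 by rewrite mulr_ge0// divr_ge0// ltW.
have kq2 : 0 <= k / 2 * q2 by rewrite mulr_ge0// divr_ge0// ltW.
have n1r : n1 < r / 2 by apply: (small q1 _ (normr_ge0 _) nx); lra.
have n2r : n2 < r / 2 by apply: (small q2 _ (normr_ge0 _) nxi); lra.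
have rd : r <= d by rewrite ge_min lexx.
have rd4 : r <= d4 by rewrite !ge_min lexx orbT.
have rd5 : r <= d5 by rewrite !ge_min lexx !orbT.
have rhalf : r / 2 < r by rewrite ltr_pdivrMr// ltr_pMr// ltr1n.
exists e, z, xi; split => //; first by rewrite e0.
split.
- exact: lt_trans n1r (lt_le_trans rhalf rd).
- have -> : xi - x0 = (xpart z - x0) - (xpart z - xi).
    by rewrite opprB [RHS]addrC subrKA.
  apply: le_lt_trans (ler_normB _ _) _; apply: lt_le_trans rd.
  by rewrite (splitr r) ltrD.
- have e0d4 : 0 < e < d4 by rewrite e0.
  have n1d4 : n1 < d4 by exact: lt_trans n1r (lt_le_trans rhalf rd4).
  have n1d5 : n1 < d5 by exact: lt_trans n1r (lt_le_trans rhalf rd5).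
  have := h4 _ _ e0d4 Kz n1d4.
  have : `|phi x0 - phi (xpart z)| < d / 2 by apply: h5; rewrite -ball_normE /= distrC.
  rewrite !ltr_distl => /andP[f1 f2] ?; apply/andP; split; last by lra.
  by lra.
- by move=> w eta Kw Deta; exact: (mx (w, eta) (conj Kw Deta)).
Qed.

End PenalisedMaxima.

(** * First-order expansion at the top and bottom faces *)
Lemma within_cvg (T S : topologicalType) (A : set T) (f : T -> S)
    (I : Type) (G : set_system I) (FG : Filter G) (t : I -> T) (t0 : T) :
  {within A, continuous f} -> A t0 -> t @ G --> t0 ->
  (\forall i \near G, A (t i)) -> f (t i) @[i --> G] --> f t0.
Proof.
move=> /subspace_continuousP cf At0 tt0 At; apply: cvg_comp (cf _ At0).
by move=> P /= PA; apply: filterS2 (tt0 _ PA) At => i; apply.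
Qed.

Section BoundaryExpansion.
Variables (R : realType) (N : nat) (D : set 'rV[R]_N).
Variables (I : Type) (G : set_system I).
Context {FG : ProperFilter G}.
Variables (e : I -> R) (x xi : I -> 'rV[R]_N) (x0 : 'rV[R]_N).
Hypothesis e_cvg : e @ G --> (0 : R).
Hypothesis e_gt0 : \forall i \near G, 0 < e i.
Hypothesis x_cvg : x @ G --> x0.
Hypothesis Dx : \forall i \near G, D (x i).
Hypothesis Dx0 : D x0.
Hypothesis h_cvg : (e i)^-1 *: (x i - xi i) @[i --> G] --> (0 : 'rV[R]_N).

(** A remainder that is [o(|y|)] uniformly in the base point is [o(e)] at
    height [y = e * g x], because [g] is bounded near [x0]. *)
Lemma cvg0_remainder (V : normedModType R) (f : 'rV[R]_N -> R -> V)
    (g : 'rV[R]_N -> R) :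
  g (x i) @[i --> G] --> g x0 ->
  (forall d : R, 0 < d -> \forall y \near (0 : R), forall x, D x ->
     `|f x y| <= d * `|y|) ->
  (e i)^-1 *: f (x i) (e i * g (x i)) @[i --> G] --> (0 : V).
Proof.
move=> gx f_small; apply/cvgr0Pnorm_lt => eta eta0.
have M0 : 0 < `|g x0| + 1 by rewrite ltr_wpDl.
have d0 : 0 < eta / (`|g x0| + 1) by rewrite divr_gt0.
have height_cvg0 : e i * g (x i) @[i --> G] --> (0 : R).
  by rewrite -[X in _ --> X](mul0r (g x0)); exact: cvgM.
have gM : \forall i \near G, `|g (x i)| < `|g x0| + 1.
  by apply: (cvgr_lt `|g x0|); [exact: cvg_norm|rewrite ltrDl].
have fy := height_cvg0 _ (f_small _ d0).
near=> i.
have ei : 0 < e i by near: i.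
have gi : `|g (x i)| < `|g x0| + 1 by near: i.
have Di : D (x i) by near: i.
have /(_ _ Di) fi : forall x', D x' -> `|f x' (e i * g (x i))| <=
    eta / (`|g x0| + 1) * `|e i * g (x i)|.
  by near: i; exact: fy.
rewrite normrZ gtr0_norm ?invr_gt0// mulrC ltr_pdivrMr//.
apply: le_lt_trans fi _; rewrite normrM gtr0_norm// mulrCA mulrC ltr_pM2r//.
by rewrite mulrAC ltr_pdivrMr// ltr_pM2l.
Unshelve. all: by end_near. Qed.

(* [sg] is 1 at the top face and -1 at the bottom face. *)
Variables (sg k m s : R) (q : 'rV[R]_N).
Variables (g a bo l : 'rV[R]_N -> R) (go kk Dphi : 'rV[R]_N -> 'rV[R]_N).
Variables (gamma : 'rV[R]_N -> R -> 'rV[R]_N) (beta : 'rV[R]_N -> R -> R).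
Hypothesis g_cvg : g (x i) @[i --> G] --> g x0.
Hypothesis l_cvg : l (x i) @[i --> G] --> l x0.
Hypothesis go_cvg : go (x i) @[i --> G] --> go x0.
Hypothesis kk_cvg : kk (x i) @[i --> G] --> kk x0.
Hypothesis Dphi_cvg : Dphi (x i) @[i --> G] --> Dphi x0.
Hypothesis a_def : forall x, a x = bo x - dot (go x) (Dphi x).
Hypothesis a_diff :
  (e i)^-1 * (a (xi i) - a (x i) + dot q (x i - xi i)) @[i --> G] --> (0 : R).
Hypothesis gamma_exp : forall d : R, 0 < d ->
  \forall y \near (0 : R), forall x, D x ->
    `|gamma x y - (sg *: go x + y *: kk x)| <= d * `|y|.
Hypothesis beta_exp : forall d : R, 0 < d ->
  \forall y \near (0 : R), forall x, D x ->
    `|beta x y - (sg * bo x + l x * y)| <= d * `|y|.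

(** Divided by [e], the difference of the two sides tends to the quantity
    assumed positive: by the choice of [a] the terms of order 0 cancel, and
    the remainders, the shift [x - xi] and the affine approximation of [a] at
    [xi] all contribute [o(e)]. *)
Lemma boundary_expansion :
  0 < g x0 * (dot (kk x0) (Dphi x0) + sg * (dot (go x0) q + m) - l x0) + sg * s ->
  \forall i \near G,
   beta (x i) (e i * g (x i)) <
   dot (gamma (x i) (e i * g (x i)))
     (Dphi (x i) + k *: (x i - xi i) + (e i * g (x i)) *: q) +
   sg * (a (xi i) + dot q (x i - xi i) + m * (e i * g (x i)) + e i * s).
Proof.
move=> Lgt0.
pose rg i := (e i)^-1 *: (gamma (x i) (e i * g (x i)) -
  (sg *: go (x i) + (e i * g (x i)) *: kk (x i))).
pose rb i := (e i)^-1 *: (beta (x i) (e i * g (x i)) -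
  (sg * bo (x i) + l (x i) * (e i * g (x i))) : R^o).
pose ra i := (e i)^-1 * (a (xi i) - a (x i) + dot q (x i - xi i)).
pose h i := (e i)^-1 *: (x i - xi i).
have rg0 : rg @ G --> (0 : 'rV[R]_N) by exact: cvg0_remainder gamma_exp.
have rb0 : rb @ G --> (0 : R) by exact: (@cvg0_remainder R^o _ g) beta_exp.
(* the difference of the two sides divided by [e] *)
pose E i := dot (sg *: go (x i) + (e i * g (x i)) *: kk (x i) + e i *: rg i)
              (k *: h i + g (x i) *: q) +
            dot (g (x i) *: kk (x i) + rg i) (Dphi (x i)) +
            sg * (ra i + g (x i) * m + s) - g (x i) * l (x i) - rb i.
have y0 : e i * g (x i) @[i --> G] --> (0 * g x0 : R) by exact: cvgM.
have EL : E @ G --> dot (sg *: go x0 + (0 * g x0) *: kk x0 + (0 : R) *: 0)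
              (k *: 0 + g x0 *: q) +
            dot (g x0 *: kk x0 + 0) (Dphi x0) +
            sg * (0 + g x0 * m + s) - g x0 * l x0 - 0.
  apply: cvgB => //; apply: cvgB; last exact: cvgM.
  apply: cvgD; last first.
    apply: cvgM; first exact: cvg_cst.
    apply: cvgD; last exact: cvg_cst.
    by apply: cvgD => //; apply: cvgM => //; exact: cvg_cst.
  apply: cvgD.
    apply: cvg_dot.
      apply: cvgD; last exact: cvgZ.
      apply: cvgD; last exact: cvgZ.
      by apply: cvgZ => //; exact: cvg_cst.
    apply: cvgD; first by apply: cvgZ => //; exact: cvg_cst.
    by apply: cvgZ => //; exact: cvg_cst.
  apply: cvg_dot => //; apply: cvgD => //; exact: cvgZ.
have : \forall i \near G, 0 < E i.
  apply: cvgr_gt EL _ _; move: Lgt0; congr (_ < _).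
  rewrite !mul0r !scale0r !scaler0 !addr0 !add0r subr0.
  by rewrite !dotZl !dotZr; ring.
move=> E0; near=> i.
have ei : 0 < e i by near: i.
have Ei : 0 < E i by near: i.
have ei0 : e i != 0 by rewrite gt_eqF.
set y := e i * g (x i); have gammaE : gamma (x i) y = sg *: go (x i) + y *: kk (x i) + e i *: rg i.
  by rewrite /rg scalerA divff// scale1r addrC subrK.
have betaE : beta (x i) y = sg * bo (x i) + l (x i) * y + e i * rb i.
  by rewrite /rb -[_ *: _]/(_ * _) mulVKf// addrC subrK.
have aE : a (xi i) = a (x i) - dot q (x i - xi i) + e i * ra i.
  by rewrite /ra mulVKf//; ring.
have xE : x i - xi i = e i *: h i by rewrite /h scalerA divff// scale1r.
have -> : Dphi (x i) + k *: (x i - xi i) + y *: q =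
    Dphi (x i) + e i *: (k *: h i + g (x i) *: q).
  by rewrite -addrA [in LHS]xE /y !scalerDr !scalerA [k * _]mulrC.
rewrite -subr_gt0 betaE aE a_def dotDr dotZr.
have := mulr_gt0 ei Ei; rewrite /E -gammaE; set DW := dot _ (_ + _).
congr (_ < _); rewrite gammaE /y !dotDl !dotZl; ring.
Unshelve. all: by end_near. Qed.

End BoundaryExpansion.

(** * Geometry of the thin domain *)
Section ThinGeometry.
Variables (R : realType) (N : nat) (Omega : set 'rV[R]_N).
Variables (gp gm : 'rV[R]_N -> R).
Hypotheses (gp_cont : continuous gp) (gm_cont : continuous gm).
Implicit Types (x : 'rV[R]_N) (z : 'rV[R]_(N + 1)) (e : R).

Lemma closed_le_fun (T : topologicalType) (f g : T -> R) :
  continuous f -> continuous g -> closed [set t | f t <= g t].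
Proof.
move=> cf cg.
have -> : [set t | f t <= g t] = (fun t => g t - f t) @^-1` [set y | 0 <= y].
  by apply/seteqP; split => t /=; rewrite subr_ge0.
have /continuous_closedP : continuous (fun t => g t - f t).
  by move=> t; apply: cvgB; [exact: cg|exact: cf].
by apply; exact: closed_ge.
Qed.

Lemma bdry_closed : closed (bdry Omega).
Proof.
by apply: closedI; [exact: closed_closure|exact/open_closedC/open_interior].
Qed.

Lemma closure_thin e z : closure (thin Omega gp gm e) z ->
  closure Omega (xpart z) /\ e * gm (xpart z) <= ypart z <= e * gp (xpart z).
Proof.
pose B1 := @xpart R N @^-1` closure Omega.
pose B2 := [set z : 'rV[R]_(N + 1) | e * gm (xpart z) <= ypart z].
pose B3 := [set z : 'rV[R]_(N + 1) | ypart z <= e * gp (xpart z)].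
have cg g : continuous g -> continuous (fun z : 'rV[R]_(N + 1) => e * g (xpart z)).
  move=> gc z'; apply: (@cvgM _ _ _ (nbhs_filter z')); first exact: cvg_cst.
  by apply: continuous_comp; [exact: xpart_continuous|exact: gc].
have c1 : closed B1.
  have /continuous_closedP : continuous (@xpart R N) by exact: xpart_continuous.
  by apply; exact: closed_closure.
have c2 : closed B2 by apply: closed_le_fun; [exact: cg|exact: ypart_continuous].
have c3 : closed B3 by apply: closed_le_fun; [exact: ypart_continuous|exact: cg].
have cB : closed (B1 `&` (B2 `&` B3)) by apply: closedI => //; exact: closedI.
have sub : thin Omega gp gm e `<=` B1 `&` (B2 `&` B3).
  move=> w [Ow /andP[/ltW w1 /ltW w2]]; split; first exact: subset_closure.
  by split.
move=> /(closure_subset sub); rewrite -(iffLR (closure_id _) cB).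
by case=> ? [? ?]; split => //; apply/andP.
Qed.

Hypothesis hg : forall x, closure Omega x -> gm x < gp x.

Lemma thin_column e x : 0 < e -> Omega x ->
  exists2 z, closure (thin Omega gp gm e) z & xpart z = x.
Proof.
move=> e0 Ox; exists (row_mx x (e * ((gm x + gp x) / 2))%:M); last exact: xpart_row.
apply: subset_closure; split; rewrite xpart_row// ypart_row !ltr_pM2l//.
by have [-> ->] := midf_lt (hg (subset_closure Ox)).
Qed.

Lemma thin_meets_columns x (d : R) :
  closure Omega x -> 0 < d -> exists (e : R) z,
  [/\ 0 < e < d, closure (thin Omega gp gm e) z & `|xpart z - x| < d].
Proof.
move=> /(_ _ (nbhsx_ballx x d _)) cx d0; have [x' [Ox' xx']] := cx d0.
have d20 : 0 < d / 2 by rewrite divr_gt0.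
have [z Kz zx'] := thin_column d20 Ox'; exists (d / 2), z; split => //.
- by rewrite d20 /= ltr_pdivrMr// ltr_pMr// ltr1n.
- by rewrite zx' distrC; move: xx'; rewrite -ball_normE.
Qed.

Lemma row_mx_continuous :
  continuous (fun t : 'rV[R]_N * R => row_mx t.1 t.2%:M : 'rV[R]_(N + 1)).
Proof.
move=> t; apply: (cvg_mx (nbhs_filter t)) => i j; rewrite ord1.
case: (split_ordP j) => k ->.
  rewrite row_mxEl; under eq_fun do rewrite row_mxEl.
  by apply: cvg_coord; exact: cvg_fst.
rewrite row_mxEr ord1 mxE eqxx mulr1n.
under eq_fun do rewrite row_mxEr mxE eqxx mulr1n.
exact: cvg_snd.
Qed.

Lemma bounded_on (D : set 'rV[R]_N) (f : 'rV[R]_N -> R) : compact D ->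
  continuous f -> exists2 M, 0 < M & forall x, D x -> `|f x| <= M.
Proof.
move=> cD cf; have : compact (f @` D).
  by apply: continuous_compact => //; exact: continuous_subspaceT.
move=> /(@compact_bounded _ R^o)[M [Mr hM]]; exists (`|M| + 1).
  by rewrite ltr_wpDl.
move=> x Dx; apply: hM; last by exists x.
by rewrite (le_lt_trans (ler_norm M))// ltrDl.
Qed.

Hypothesis Omega_bounded : bounded_set Omega.

Lemma compact_closure : compact (closure Omega).
Proof.
apply: bounded_closed_compact; last exact: closed_closure.
have [M [Mr hM]] := Omega_bounded; exists M; split => // M' MM' x cx.
have cB : closed [set x : 'rV[R]_N | `|x| <= M'].
  apply: closed_le_fun; [exact: norm_continuous|exact: cst_continuous].
rewrite [_ _]/=; have : closure [set x : 'rV[R]_N | `|x| <= M'] x.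
  by apply: closure_subset cx => w Ow; exact: hM.
by rewrite -(iffLR (closure_id _) cB).
Qed.

Lemma thin_height : exists2 M, 0 < M & forall (e : R) z, 0 < e ->
  closure (thin Omega gp gm e) z -> `|ypart z| <= M * e.
Proof.
have [Mp Mp0 hp] := bounded_on compact_closure gp_cont.
have [Mm Mm0 hm] := bounded_on compact_closure gm_cont.
exists (Mp + Mm); first exact: addr_gt0.
move=> e z e0 /closure_thin[Dz /andP[yl yu]].
have := hp _ Dz; rewrite ler_norml => /andP[_ hp'].
have := hm _ Dz; rewrite ler_norml => /andP[hm' _].
rewrite ler_norml; apply/andP; split.
  apply: le_trans yl; rewrite mulrC -mulrN ler_pM2l//; lra.
by apply: le_trans yu _; rewrite [leRHS]mulrC ler_pM2l//; lra.
Qed.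

Lemma compact_closure_thin e : 0 < e -> compact (closure (thin Omega gp gm e)).
Proof.
move=> e0; have [M M0 hM] := thin_height.
have cP : compact (closure Omega `*` `[- (M * e), M * e]).
  by apply: compact_setX; [exact: compact_closure|exact: segment_compact].
have := @continuous_compact _ _ _ _ (continuous_subspaceT row_mx_continuous) cP.
move=> cI; apply: (subclosed_compact _ cI); first exact: closed_closure.
move=> z Kz; exists (xpart z, ypart z); last by rewrite -row_mx_xypart.
split; first by have [] := closure_thin Kz.
by rewrite /= in_itv /= -ler_norml; exact: hM.
Qed.

End ThinGeometry.

(** * The corrected test function and the limit operator *)
Section TestFunction.
Variables (R : realType) (N : nat).
Variables (phi a : 'rV[R]_N -> R) (k m s : R) (q : 'rV[R]_N).
Implicit Types (e : R) (x xi : 'rV[R]_N) (z : 'rV[R]_(N + 1)).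

Definition corrector e xi z : R :=
  ypart z * (a xi + dot q (xpart z - xi)) + m / 2 * ypart z ^+ 2 + e * s * ypart z.

Definition layer_mx : 'M[R]_(N + 1) := block_mx k%:M q^T q m%:M.

(** The penalised test function for a fixed centre [xi], up to an additive
    constant (see [penalisedE]).  Written as [phi] plus a quadratic function of
    [z] it is visibly of class C^2, and its gradient and Hessian come from
    [grad_quad] and [hess_quad]. *)
Definition layer_test e xi z : R := phi (xpart z) +
  quad (row_mx (- k *: xi) (a xi - dot q xi + e * s)%:M) layer_mx z.

Lemma layer_mx_sym : symmx layer_mx.
Proof. by rewrite /symmx /= tr_block_mx !tr_scalar_mx trmxK. Qed.

Lemma scalar_mx1D (b c : R) : (b + c)%:M = b%:M + c%:M :> 'M[R]_1.
Proof. exact: raddfD. Qed.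

Lemma mulmx_tr_dot x xi : x *m xi^T = (dot x xi)%:M.
Proof.
apply/matrixP => i j; rewrite !ord1 !mxE eqxx mulr1n.
by apply: eq_bigr => l _; rewrite mxE.
Qed.

Lemma mul_layer_mx z :
  z *m layer_mx = row_mx (k *: xpart z + ypart z *: q)
                         (dot (xpart z) q + ypart z * m)%:M.
Proof.
rewrite {1}(row_mx_xypart z) mul_row_block mul_mx_scalar mul_scalar_mx mulmx_tr_dot.
by rewrite -scalar_mxM -scalar_mx1D.
Qed.

Lemma penalisedE e xi z : penalised phi k corrector e xi z =
  layer_test e xi z + k / 2 * dot xi xi.
Proof.
rewrite /penalised /layer_test /corrector /quad -scalemxAr mul_layer_mx.
rewrite scale_row_mx scale_scalar_mx add_row_mx -scalar_mx1D.
rewrite [X in dot (row_mx _ _) X]row_mx_xypart dot_row_mx.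
rewrite !(dotDl, dotDr, dotNl, dotNr, dotZl, dotZr).
by rewrite (dotC xi (xpart z)) (dotC q (xpart z)); field.
Qed.

Hypothesis phi_C2 : C2 phi.

Lemma C2_layer_test e xi : C2 (layer_test e xi).
Proof. by apply: C2D; [exact: C2_xpart|exact/C2_quad/layer_mx_sym]. Qed.

Lemma grad_layer_test e xi z : grad (layer_test e xi) z =
  row_mx (grad phi (xpart z) + k *: (xpart z - xi) + ypart z *: q)
    (a xi + dot q (xpart z - xi) + m * ypart z + e * s)%:M.
Proof.
have [C1phi _] := phi_C2.
rewrite gradD; last 2 first.
- exact: C1_xpart.
- by have [] := C2_quad (row_mx (- k *: xi) (a xi - dot q xi + e * s)%:M)
    layer_mx_sym.
rewrite grad_xpart grad_quad; last exact: layer_mx_sym.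
rewrite mul_layer_mx !add_row_mx add0r -scalar_mx1D; congr (row_mx _ _%:M).
  by rewrite scalerDr scalerN scaleNr; rewrite addrA [in RHS]addrA -!addrA [- _ + _]addrCA !addrA.
by rewrite dotDr dotNr (dotC (xpart z)); ring.
Qed.

Lemma hess_layer_test e xi z : hess (layer_test e xi) z =
  block_mx (hess phi (xpart z) + k%:M) q^T q m%:M.
Proof.
rewrite hessD; [|exact: C2_xpart|exact/C2_quad/layer_mx_sym].
by rewrite hess_xpart// hess_quad ?add_block_mx ?add0r//; exact: layer_mx_sym.
Qed.

Lemma corrector_continuous e : continuous a ->
  continuous (fun t : 'rV[R]_(N + 1) * 'rV[R]_N => corrector e t.2 t.1).
Proof.
move=> ca t.
have cx : xpart t'.1 @[t' --> t] --> xpart t.1.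
  by apply: continuous_comp; [exact: cvg_fst|exact: xpart_continuous].
have cy : ypart t'.1 @[t' --> t] --> ypart t.1.
  by apply: continuous_comp; [exact: cvg_fst|exact: ypart_continuous].
have cd : xpart t'.1 - t'.2 @[t' --> t] --> xpart t.1 - t.2.
  by apply: cvgB => //; exact: cvg_snd.
apply: cvgD; last by apply: cvgM => //; exact: cvg_cst.
apply: cvgD; last first.
  by apply: cvgM; [exact: cvg_cst|apply: cvgM].
apply: cvgM => //; apply: cvgD; last first.
  by apply: (cvg_dot (nbhs_filter t)) => //; exact: cvg_cst.
by apply: continuous_comp; [exact: cvg_snd|exact: ca].
Qed.

Lemma corrector_small (D : set 'rV[R]_N) (K : R -> set 'rV[R]_(N + 1)) (e1 M : R) :
  compact D -> continuous a -> 0 < e1 -> 0 < M ->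
  (forall (e : R) z, 0 < e < e1 -> K e z -> D (xpart z)) ->
  (forall (e : R) z, 0 < e < e1 -> K e z -> `|ypart z| <= M * e) ->
  forall d : R, 0 < d -> exists2 d' : R, 0 < d' &
  forall (e : R) z xi, 0 < e < d' -> K e z -> D xi -> `|corrector e xi z| <= d.
Proof.
move=> cD ca e10 M0 xK yK d d0.
have [A A0 hA] := bounded_on cD ca.
have cq : continuous (fun x => dot q x).
  by move=> x; apply: (cvg_dot (nbhs_filter x)); [exact: cvg_cst|exact: cvg_id].
have [B B0 hB] := bounded_on cD cq.
pose W := A + (B + B) + `|m| * M + `|s|.
have mM : 0 <= `|m| * M by rewrite mulr_ge0// ltW.
have W0 : 0 < W by rewrite /W; have := normr_ge0 s; lra.
exists (Num.min (Num.min e1 1) (d / (M * W))).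
  by rewrite !lt_min e10 ltr01 divr_gt0// mulr_gt0.
move=> e z xi; rewrite !lt_min => /andP[e0 /andP[/andP[ee1 el1] ed]] Kz Dxi.
have ee : 0 < e < e1 by rewrite e0.
have y := yK _ _ ee Kz; have Dz := xK _ _ ee Kz.
have yM : `|ypart z| <= M.
  by apply: le_trans y _; rewrite ger_pMr// ltW.
have -> : corrector e xi z =
    ypart z * (a xi + (dot q (xpart z) - dot q xi) + m / 2 * ypart z + e * s).
  by rewrite /corrector dotDr dotNr; ring.
rewrite normrM; apply: (@le_trans _ _ (M * e * W)); last first.
  by rewrite mulrAC -ler_pdivlMl ?mulr_gt0// mulrC ltW.
apply: ler_pM => //; apply: le_trans (ler_normD _ _) _; apply: lerD; last first.
  by rewrite normrM gtr0_norm// ler_piMl//; exact: ltW.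
apply: le_trans (ler_normD _ _) _; apply: lerD; last first.
  rewrite !normrM; apply: ler_pM => //.
  by rewrite ler_piMr// gtr0_norm//; lra.
apply: le_trans (ler_normD _ _) _; apply: lerD; first exact: hA.
by apply: le_trans (ler_normB _ _) _; apply: lerD; exact: hB.
Qed.

End TestFunction.

Lemma dot_mulmx (R : realType) n p (u : 'rV[R]_n) (A : 'M[R]_(n, p)) (v : 'rV[R]_p) :
  dot (u *m A) v = dot u (v *m A^T).
Proof.
have dotmx j (w w' : 'rV[R]_j) : dot w w' = (w *m w'^T) 0 0.
  by rewrite mulmx_tr_dot mxE eqxx mulr1n.
by rewrite !dotmx trmx_mul trmxK mulmxA.
Qed.

Section LimitMatrix.
Variables (R : realType) (N : nat) (gp gm : 'rV[R]_N -> R).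
Variables (go : 'rV[R]_N -> 'rV[R]_N) (bo : 'rV[R]_N -> R).
Variables (kp km : 'rV[R]_N -> 'rV[R]_N) (lp lm : 'rV[R]_N -> R).
Implicit Types (X : 'M[R]_N) (p x : 'rV[R]_N).

(** The Hessian at which [F] is evaluated in the limit operator. *)
Definition limit_mx X p x : 'M[R]_(N + 1) :=
  let g := go x in
  let Dg := Dmx go x in
  let Db := grad bo x in
  let b := g *m Dg^T
           - (gp x - gm x)^-1 *: (gp x *: kp x + gm x *: km x) in
  let c := - dot g Db + (gp x * lp x + gm x * lm x) / (gp x - gm x) in
  block_mx X (- (X *m g^T)) (- (g *m X)) (g *m X *m g^T) +
  block_mx 0 (- (p *m Dg)^T) (- (p *m Dg)) (dot b p)%:M +
  block_mx 0 Db^T Db c%:M.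

Lemma limit_opE F X p r x :
  limit_op gp gm F go bo kp km lp lm X p r x =
  F (limit_mx X p x) (row_mx p (bo x - dot (go x) p)%:M) r x 0.
Proof. by []. Qed.

(** The mixed second derivative of the corrected test function: it is the
    gradient of the slope [bo - dot go (grad phi)] when [p] and [X] are the
    gradient and the Hessian of [phi]. *)
Definition slope_grad X p x : 'rV[R]_N :=
  grad bo x - (p *m Dmx go x + go x *m X).

Definition vertical_hess X p x : R :=
  (gp x * (lp x - dot (kp x) p) + gm x * (lm x - dot (km x) p)) / (gp x - gm x)
  - dot (go x) (slope_grad X p x).

(** The sum of the three blocks in the limit operator is the Hessian of the
    corrected test function: the vertical second derivative is the value of [m]
    for which the first-order terms at the two faces, weighted by their
    heights, add up to 0. *)
Lemma limit_mxE X p x : symmx X ->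
  limit_mx X p x = block_mx X (slope_grad X p x)^T (slope_grad X p x)
                            (vertical_hess X p x)%:M.
Proof.
move=> sX; rewrite /limit_mx !add_block_mx !addr0; congr block_mx.
- rewrite /slope_grad [RHS]linearB /= [(_ + _)^T]linearD /= [(go x *m X)^T]trmx_mul.
  by rewrite [X^T]sX opprD [RHS]addrC [- (p *m _)^T + _]addrC.
- by rewrite /slope_grad opprD addrC [- (go x *m X) + _]addrC.
- rewrite !mulmx_tr_dot -!scalar_mx1D; congr _%:M; rewrite /vertical_hess /slope_grad.
  rewrite !(dotDl, dotDr, dotNl, dotNr, dotZl, dotZr).
  rewrite (dot_mulmx _ _ p) trmxK (dotC (go x) (go x *m X)).
  rewrite !(dotC _ p) !(dotC _ (kp x)) !(dotC _ (km x)).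
  set ig := (_ - _)^-1; ring.
Qed.

End LimitMatrix.

(** * Passing to the limit in the equation and in the lateral condition *)
Lemma cvg_pair_nbhs (I : Type) (G : set_system I) (FG : Filter G)
    (U V : topologicalType) (f : I -> U) (g : I -> V) (a : U) (b : V) :
  f @ G --> a -> g @ G --> b -> (f i, g i) @[i --> G] --> (a, b).
Proof. exact: cvg_pair. Qed.

Lemma cvg_block_mx (R : realType) m n m' n' (T : Type) (F : set_system T)
    (FF : Filter F) (f : T -> 'M[R]_(m, n)) (A : 'M[R]_(m, n)) B C
    (E : 'M[R]_(m', n')) :
  f @ F --> A ->
  (block_mx (f t) B C E : 'M[R]_(m + m', n + n')) @[t --> F] -->
  (block_mx A B C E : 'M[R]_(m + m', n + n')).
Proof.
move=> fA; apply: cvg_mx => i j.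
case: (split_ordP i) => i' ->; case: (split_ordP j) => j' ->.
- rewrite block_mxEul; under eq_fun do rewrite block_mxEul.
  exact: cvg_coord.
- by rewrite block_mxEur; under eq_fun do rewrite block_mxEur; exact: cvg_cst.
- by rewrite block_mxEdl; under eq_fun do rewrite block_mxEdl; exact: cvg_cst.
- by rewrite block_mxEdr; under eq_fun do rewrite block_mxEdr; exact: cvg_cst.
Qed.

Definition lateral_sub (R : realType) (N : nat) (L : lateral R N)
    (beta : 'rV[R]_N -> R -> R) (p : 'rV[R]_N) (r : R) (x : 'rV[R]_N) :
    Prop :=
  match L with
  | Oblique gamma1 _ => dot (gamma1 x 0) p <= beta x 0
  | Dirichlet => r <= beta x 0
  end.

(* In this section [z i] is a point of the thin domain of thickness [e i],
   [xi i] the centre of the test function and [r i] the value of the envelope;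
   [slope] and [vert] are the horizontal and the vertical part of the gradient
   of the test function at [z i]. *)
Section Passage.
Variables (R : realType) (N : nat) (Omega : set 'rV[R]_N).
Variables (gp gm : 'rV[R]_N -> R).
Hypotheses (gp_cont : continuous gp) (gm_cont : continuous gm).
Hypothesis Omega_bounded : bounded_set Omega.
Local Notation D := (closure Omega).
Local Notation K e := (closure (thin Omega gp gm e)).
Variable e1 : R.
Hypothesis e1_thin : forall e : R, 0 < e < e1 ->
  forall z, K e z -> D (xpart z) /\ -1 <= ypart z <= 1.

Variables (phi a : 'rV[R]_N -> R) (k m s : R) (q : 'rV[R]_N).
Hypotheses (phi_C2 : C2 phi) (a_cont : continuous a).

Variables (I : Type) (G : set_system I).
Context {FG : ProperFilter G}.
Variables (e : I -> R) (z : I -> 'rV[R]_(N + 1)) (xi : I -> 'rV[R]_N).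
Variables (r : I -> R) (x0 : 'rV[R]_N) (r0 : R).
Hypothesis Dx0 : D x0.
Hypothesis e_cvg : e @ G --> (0 : R).
Hypothesis e_small : \forall i \near G, 0 < e i < e1.
Hypothesis Kz : \forall i \near G, K (e i) (z i).
Hypothesis x_cvg : xpart (z i) @[i --> G] --> x0.
Hypothesis h_cvg : (e i)^-1 *: (xpart (z i) - xi i) @[i --> G] --> (0 : 'rV[R]_N).
Hypothesis r_cvg : r @ G --> r0.

Let x i := xpart (z i).
Let y i := ypart (z i).
Let slope i := grad phi (x i) + k *: (x i - xi i) + y i *: q.
Let vert i := a (xi i) + dot q (x i - xi i) + m * y i + e i * s.

Lemma height_cvg0 : y @ G --> (0 : R).
Proof.
have [M M0 hM] := thin_height gp_cont gm_cont Omega_bounded.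
have Me0 : M * e i @[i --> G] --> (0 : R).
  by rewrite -[X in _ --> X](mulr0 M); apply: cvgM => //; exact: cvg_cst.
apply/cvgr0Pnorm_lt => d d0.
have Med := cvgr_lt 0 Me0 d d0.
near=> i.
have /andP[ei _] : 0 < e i < e1 by near: i.
by apply: le_lt_trans (hM _ _ ei _) _; near: i; [exact: Kz|exact: Med].
Unshelve. all: by end_near. Qed.

Lemma base_near : \forall i \near G, D (x i) /\ -1 <= y i <= 1.
Proof.
near=> i; apply: (e1_thin (e := e i)); near: i; [exact: e_small|exact: Kz].
Unshelve. all: by end_near. Qed.

Lemma centre_diff_cvg0 : x i - xi i @[i --> G] --> (0 : 'rV[R]_N).
Proof.
have : e i *: ((e i)^-1 *: (x i - xi i)) @[i --> G] --> (0 *: 0 : 'rV[R]_N).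
  exact: cvgZ.
rewrite scaler0; apply: cvg_trans; apply: near_eq_cvg; near=> i.
have /andP[ei _] : 0 < e i < e1 by near: i.
by rewrite scalerA divff ?gt_eqF// scale1r.
Unshelve. all: by end_near. Qed.

Lemma centre_cvg : xi @ G --> x0.
Proof.
rewrite -[x0]subr0; have -> : xi = fun i => x i - (x i - xi i).
  by apply/funext => i; rewrite subKr.
by apply: cvgB => //; exact: centre_diff_cvg0.
Qed.

Lemma slope_cvg : slope @ G --> grad phi x0.
Proof.
have [C1phi _] := phi_C2.
rewrite -[grad phi x0]addr0 -[X in X + 0]addr0.
apply: cvgD; last first.
  by rewrite -(scale0r q); apply: cvgZ; [exact: height_cvg0|exact: cvg_cst].
apply: cvgD; last first.
  by rewrite -(scaler0 _ k); apply: cvgZ; [exact: cvg_cst|exact: centre_diff_cvg0].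
by apply: cvg_comp x_cvg _; exact: grad_continuous.
Qed.

Lemma vert_cvg : vert @ G --> a x0.
Proof.
rewrite -[a x0]addr0 -[X in X + 0]addr0 -[X in X + 0 + 0]addr0.
apply: cvgD; last first.
  by rewrite -(mul0r s); apply: cvgM => //; exact: cvg_cst.
apply: cvgD; last first.
  by rewrite -(mulr0 m); apply: cvgM; [exact: cvg_cst|exact: height_cvg0].
apply: cvgD; first by apply: cvg_comp centre_cvg _; exact: a_cont.
rewrite -(dot0l q) dotC; apply: cvg_dot; [exact: cvg_cst|exact: centre_diff_cvg0].
Qed.

Lemma interior_limit
    (F : 'M[R]_(N + 1) -> 'rV[R]_(N + 1) -> R -> 'rV[R]_N -> R -> R) :
  {within @symmx R (N + 1) `*` setT `*` setT `*` D `*` `[-1, 1],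
    continuous (fun t : 'M[R]_(N + 1) * 'rV[R]_(N + 1) * R * 'rV[R]_N * R =>
      let: (X, p, r, x, y) := t in F X p r x y)} ->
  0 < F (block_mx (hess phi x0 + k%:M) q^T q m%:M)
        (row_mx (grad phi x0) (a x0)%:M) r0 x0 0 ->
  \forall i \near G, 0 < F (block_mx (hess phi (x i) + k%:M) q^T q m%:M)
        (row_mx (slope i) (vert i)%:M) (r i) (x i) (y i).
Proof.
move=> hF; apply: cvgr_gt.
pose X i : 'M[R]_(N + 1) := block_mx (hess phi (x i) + k%:M) q^T q m%:M.
have symX w : symmx (block_mx (hess phi w + k%:M) q^T q m%:M : 'M[R]_(N + 1)).
  rewrite /symmx /= tr_block_mx !tr_scalar_mx trmxK linearD /= tr_scalar_mx.
  by rewrite (hess_sym w phi_C2).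
have X_cvg : X @ G --> (block_mx (hess phi x0 + k%:M) q^T q m%:M : 'M[R]_(N + 1)).
  apply: cvg_block_mx; apply: cvgD; last exact: cvg_cst.
  by apply: cvg_comp x_cvg _; exact: hess_continuous.
have P_cvg : (row_mx (slope i) (vert i)%:M : 'rV[R]_(N + 1)) @[i --> G] -->
    (row_mx (grad phi x0) (a x0)%:M : 'rV[R]_(N + 1)).
  have sv : (slope i, vert i) @[i --> G] --> (grad phi x0, a x0).
    exact: cvg_pair_nbhs slope_cvg vert_cvg.
  exact: cvg_comp sv (@row_mx_continuous R N (grad phi x0, a x0)).
have FGf : Filter G by typeclasses eauto.
have c1 := cvg_pair_nbhs FGf X_cvg P_cvg.
have c2 := cvg_pair_nbhs FGf c1 r_cvg.
have c3 := cvg_pair_nbhs FGf c2 x_cvg.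
have t_cvg := cvg_pair_nbhs FGf c3 height_cvg0.
apply: (within_cvg FGf hF _ t_cvg).
  split; last by rewrite /= in_itv /= oppr_le0 ler01.
  by split => //; split => //; split => //; exact: symX.
near=> i; have [Dx yi] : D (x i) /\ -1 <= y i <= 1 by near: i; exact: base_near.
split; last by rewrite /= in_itv.
by split => //; split => //; split => //; exact: symX.
Unshelve. all: by end_near. Qed.

Variables (nu : 'rV[R]_N -> 'rV[R]_N) (L : lateral R N).
Variable beta : 'rV[R]_N -> R -> R.
Hypothesis hbeta : {within bdry Omega `*` `[-1, 1],
  continuous (fun t : 'rV[R]_N * R => beta t.1 t.2)}.
Hypothesis hL : lateral_admissible Omega nu L.

(** The points on the lateral boundary may or may not be frequent along [G], so
    the limit is taken along the trace of [G] on them, which may be improper.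
    In the oblique case the vertical part of the gradient drops out since the
    vertical component of the direction vanishes at height 0. *)
Lemma lateral_limit :
  ~ (bdry Omega x0 /\ lateral_sub L beta (grad phi x0) r0 x0) ->
  \forall i \near G, ~ (thin_lateral Omega gp gm (e i) (z i) /\ match L with
      | Oblique gamma1 gamma2 =>
        dot (row_mx (gamma1 (x i) (y i)) (gamma2 (x i) (y i))%:M)
            (row_mx (slope i) (vert i)%:M) <= beta (x i) (y i)
      | Dirichlet => r i <= beta (x i) (y i)
      end).
Proof.
move=> nlat; pose G' := within (fun i => bdry Omega (x i)) G.
have FG' : Filter G' by exact: within_filter.
have GG' (P : set I) : (\forall i \near G, P i) -> \forall i \near G', P i.
  by apply: filterS.
have [nb|b] := pselect (bdry Omega x0); last first.
  have : \forall x \near x0, ~ bdry Omega x.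
    have : open (~` bdry Omega) by exact/closed_openC/bdry_closed.
    by move=> op; exact: open_nbhs_nbhs (conj op b).
  move=> nb0; have : \forall i \near G, ~ bdry Omega (x i) by exact: x_cvg nb0.
  by apply: filterS => i nbx [[bx _] _]; exact: nbx.
have bG' : \forall i \near G', bdry Omega (x i) by exact: withinT.
have x_cvg' : x @ G' --> x0 by move=> P /x_cvg /GG'.
have y_cvg' : y @ G' --> (0 : R) by move=> P /height_cvg0 /GG'.
have xy_cvg := cvg_pair_nbhs FG' x_cvg' y_cvg'.
have xyA : \forall i \near G', (bdry Omega `*` `[-1, 1]) (x i, y i).
  near=> i; split => /=; first by near: i.
  rewrite in_itv /=; have [] : D (x i) /\ -1 <= y i <= 1; last by [].
  by near: i; apply: GG'; exact: base_near.
have A0 : (bdry Omega `*` `[-1, 1]) (x0, 0 : R).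
  by split => //=; rewrite in_itv /= oppr_le0 ler01.
have beta_cvg := within_cvg FG' hbeta A0 xy_cvg xyA.
pose Q i : Prop := match L with
    | Oblique gamma1 gamma2 =>
      dot (row_mx (gamma1 (x i) (y i)) (gamma2 (x i) (y i))%:M)
          (row_mx (slope i) (vert i)%:M) <= beta (x i) (y i)
    | Dirichlet => r i <= beta (x i) (y i)
    end.
suff nQ : \forall i \near G', ~ Q i.
  have : \forall i \near G, bdry Omega (x i) -> ~ Q i by exact: nQ.
  by apply: filterS => i nQi [[bx _]]; exact: nQi.
rewrite /Q {Q}; rewrite /lateral_sub in nlat; case: L hL nlat => [gamma1 gamma2 [hg1 hg2 _ g20]|_] nlat; last first.
  have : 0 < r0 - beta x0 0.
    by rewrite subr_gt0 ltNge; apply/negP => ?; exact: nlat.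
  have rG' : r @ G' --> r0 by move=> P /r_cvg /GG'.
  move=> /(cvgr_gt _ (cvgB rG' beta_cvg)); apply: filterS => i /=.
  by rewrite subr_gt0 ltNge => /negP.
have : 0 < dot (gamma1 x0 0) (grad phi x0) + gamma2 x0 0 * a x0 - beta x0 0.
  by rewrite g20// mul0r addr0 subr_gt0 ltNge; apply/negP => ?; exact: nlat.
have g1 := within_cvg FG' hg1 A0 xy_cvg xyA.
have g2 := within_cvg FG' hg2 A0 xy_cvg xyA.
have sl : slope @ G' --> grad phi x0 by move=> P /slope_cvg /GG'.
have ve : vert @ G' --> a x0 by move=> P /vert_cvg /GG'.
move=> /(cvgr_gt _ (cvgB (cvgD (cvg_dot FG' g1 sl) (cvgM g2 ve)) beta_cvg)).
apply: filterS => i /=; rewrite subr_gt0 dot_row_mx ltNge => /negP.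
by [].
Unshelve. all: by end_near. Qed.

End Passage.

(** * The filter of maximum points *)
Section MaximumPoints.
Variables (R : realType) (N : nat) (Omega : set 'rV[R]_N).
Hypothesis Omega_bounded : bounded_set Omega.
Variables (gp gm : 'rV[R]_N -> R).
Hypotheses (gp_cont : continuous gp) (gm_cont : continuous gm).
Hypothesis hg : forall x, closure Omega x -> gm x < gp x.
Local Notation D := (closure Omega).
Local Notation K := (fun e => closure (thin Omega gp gm e)).
Variables (u : R -> 'rV[R]_(N + 1) -> R) (C e1 : R).
Hypothesis e1_gt0 : 0 < e1.
Hypothesis u_bounded : forall (e : R) z, 0 < e < e1 -> K e z -> `|u e z| <= C.
Hypothesis e1_thin : forall e : R, 0 < e < e1 ->
  forall z, K e z -> D (xpart z) /\ -1 <= ypart z <= 1.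
Local Notation v := (relaxed_limsup K u).
Local Notation env e := (usc_env (K e) (u e)).

Section MaximumFilter.
Variables (phi a : 'rV[R]_N -> R) (k m s : R) (x0 : 'rV[R]_N).
Hypotheses (phi_cont : continuous phi) (a_C1 : C1 a) (k_gt0 : 0 < k).
Hypothesis Dx0 : D x0.
Hypothesis strict_max : forall x, D x ->
  v x - phi x <= v x0 - phi x0 - k / 2 * dot (x - x0) (x - x0).
Local Notation q := (grad a x0).
Local Notation pen := (penalised phi k (corrector a m s q)).
Local Notation T := (R * 'rV[R]_(N + 1) * 'rV[R]_N)%type.

(** The triples of a thickness, a maximum point and a maximising centre that
    approach [x0] with precision [d].  They generate the filter along which
    all limits below are taken. *)
Definition maxima (d : R) : set T := [set t | [/\ 0 < t.1.1 < d, K t.1.1 t.1.2,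
  D t.2 & [/\ `|xpart t.1.2 - x0| < d, `|t.2 - x0| < d,
  `|env t.1.1 t.1.2 - v x0| < d & forall w eta, K t.1.1 w -> D eta ->
    env t.1.1 w - pen t.1.1 eta w <= env t.1.1 t.1.2 - pen t.1.1 t.2 t.1.2]]].

Definition maxima_filter := filter_from [set d : R | 0 < d] maxima.

Lemma maxima_nonempty d : 0 < d -> maxima d !=set0.
Proof.
move=> d0; have [M M0 hM] := thin_height gp_cont gm_cont Omega_bounded.
have [e [z [xi [ed Kz Dxi [zx xix ev mx]]]]] : exists (e : R) z xi,
  [/\ 0 < e < d, K e z, D xi &
   [/\ `|xpart z - x0| < d, `|xi - x0| < d, `|env e z - v x0| < d &
    forall w eta, K e w -> D eta ->
      env e w - pen e eta w <= env e z - pen e xi z]].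
  apply: (penalised_maxima (thin_meets_columns hg) e1_gt0 u_bounded) => //.
  - exact: compact_closure.
  - by move=> e /andP[e0 _]; exact: compact_closure_thin.
  - by move=> e z /e1_thin h /h[].
  - by move=> e; apply: corrector_continuous; exact: C1_continuous.
  - apply: (corrector_small _ _ _ _ _ e1_gt0 M0).
    + exact: compact_closure.
    + exact: C1_continuous.
    + by move=> e z /e1_thin h /h[].
    + by move=> e z /andP[e0 _]; exact: hM.
by exists (e, z, xi).
Qed.

#[local] Instance maxima_filter_proper : ProperFilter maxima_filter.
Proof.
apply: filter_from_proper; last exact: maxima_nonempty.
apply: filter_from_filter; first by exists 1 => /=.
move=> d d' /= d0 d'0; exists (Num.min d d'); first by rewrite /= lt_min d0.
move=> t [/andP[e0 ed] Kt Dt [zx xix ev mx]].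
move: ed zx xix ev; rewrite !lt_min => /andP[? ?] /andP[? ?] /andP[? ?] /andP[? ?].
by split; split => //; rewrite e0.
Qed.

Lemma maxima_near (d : R) (P : set T) : 0 < d -> maxima d `<=` P ->
  \forall t \near maxima_filter, P t.
Proof. by move=> d0 hP; exists d. Qed.

Lemma maxima_e_cvg : t.1.1 @[t --> maxima_filter] --> (0 : R).
Proof.
apply/cvgr0Pnorm_lt => d d0; apply: (maxima_near d0) => t [/andP[e0 ed] _ _ _] /=.
by rewrite gtr0_norm.
Qed.

Lemma maxima_x_cvg : xpart t.1.2 @[t --> maxima_filter] --> x0.
Proof.
apply/cvgrPdist_lt => d d0; apply: (maxima_near d0) => t [_ _ _ [zx _ _ _]] /=.
by rewrite distrC.
Qed.

Lemma maxima_env_cvg : env t.1.1 t.1.2 @[t --> maxima_filter] --> v x0.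
Proof.
apply/cvgrPdist_lt => d d0; apply: (maxima_near d0) => t [_ _ _ [_ _ ev _]] /=.
by rewrite distrC.
Qed.

Lemma maxima_e1 : \forall t \near maxima_filter, 0 < t.1.1 < e1.
Proof. by apply: (maxima_near e1_gt0) => t []. Qed.

Lemma maxima_K : \forall t \near maxima_filter, K t.1.1 t.1.2.
Proof. by apply: (maxima_near ltr01) => t []. Qed.

(** The first hypothesis compares the maximising centre [xi] with the centre
    [x].  The gain [k / 2 * |x - xi| ^+ 2] from moving the centre is quadratic
    and the loss [|y| * w * |x - xi|] is linear, which bounds [|x - xi|]. *)
Lemma centre_distance_le (w : R) xi x (y : R) : 0 < w ->
  k / 2 * dot (x - xi) (x - xi) <= y * (a x - a xi - dot q (x - xi)) ->
  `|a x - a xi - dot q (x - xi)| <= w * `|x - xi| -> `|x - xi| <= 2 * w * `|y| / k.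
Proof.
move=> w0 ha hw; have [->|n0] := eqVneq (x - xi) 0.
  by rewrite normr0 divr_ge0 ?mulr_ge0// ltW.
have np : 0 < `|x - xi| by rewrite normr_gt0.
rewrite ler_pdivlMr// -(ler_pM2r np).
have h1 : k / 2 * `|x - xi| ^+ 2 <= `|y| * (w * `|x - xi|).
  apply: (@le_trans _ _ (k / 2 * dot (x - xi) (x - xi))).
    by rewrite ler_pM2l ?divr_gt0//; exact: normsq_le_dot.
  apply: le_trans ha _; apply: le_trans (ler_norm _) _.
  by rewrite normrM ler_wpM2l.
have -> : `|x - xi| * k * `|x - xi| = 2 * (k / 2 * `|x - xi| ^+ 2) by field.
have -> : 2 * w * `|y| * `|x - xi| = 2 * (`|y| * (w * `|x - xi|)) by ring.
by rewrite ler_pM2l.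
Qed.

(** The height is of order [e], and by strict differentiability of [a] the
    constant [w] in [centre_distance_le] can be taken arbitrarily small: the
    distance between the base point and the centre is [o(e)]. *)
Lemma maxima_h_cvg :
  (t.1.1)^-1 *: (xpart t.1.2 - t.2) @[t --> maxima_filter] --> (0 : 'rV[R]_N).
Proof.
have [M M0 hM] := thin_height gp_cont gm_cont Omega_bounded.
apply/cvgr0Pnorm_lt => d d0.
pose w := d * k / (4 * M).
have w0 : 0 < w by rewrite divr_gt0 ?mulr_gt0.
have [d1 d10 hd1] := C1_strict_diff x0 a_C1 w0.
apply: (maxima_near d10) => -[[e z] xi] [/= /andP[e0 ed] Kz Dxi [zx xix _ mx]].
have [Dz _] := closure_thin gp_cont gm_cont Kz.
have := mx z (xpart z) Kz Dz.
rewrite lerD2l lerN2 /penalised /corrector /= subrr dot0l (dotC q 0) dot0l => h.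
have hk : k / 2 * dot (xpart z - xi) (xpart z - xi) <=
    ypart z * (a (xpart z) - a xi - dot q (xpart z - xi)) by lra.
have shift := centre_distance_le w0 hk.
have {}shift := shift (hd1 _ _ zx xix).
rewrite normrZ gtr0_norm ?invr_gt0// mulrC ltr_pdivrMr//.
apply: le_lt_trans shift _.
have y := hM e z e0 Kz.
have : 2 * w * `|ypart z| <= 2 * w * (M * e) by rewrite ler_wpM2l// mulr_ge0// ltW.
rewrite ltr_pdivrMr// => y2; apply: le_lt_trans y2 _.
have -> : 2 * w * (M * e) = d * e * k / 2 by rewrite /w; field; rewrite gt_eqF.
have : 0 < d * e * k by rewrite !mulr_gt0.
by lra.
Qed.

Lemma maxima_diff_cvg :
  (t.1.1)^-1 * (a t.2 - a (xpart t.1.2) + dot q (xpart t.1.2 - t.2))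
    @[t --> maxima_filter] --> (0 : R).
Proof.
apply/cvgr0Pnorm_lt => d d0.
have [d1 d10 hd1] := C1_strict_diff x0 a_C1 ltr01.
have h : \forall t \near maxima_filter,
    `|(t.1.1)^-1 *: (xpart t.1.2 - t.2)| < d.
  by move: maxima_h_cvg => /cvgr0Pnorm_lt; apply.
have h1 : \forall t \near maxima_filter, maxima d1 t by exact: (maxima_near d10).
near=> t; have [/andP[e0 _] _ _ [zx xix _ _]] : maxima d1 t by near: t.
have : `|(t.1.1)^-1 *: (xpart t.1.2 - t.2)| < d by near: t.
apply: le_lt_trans; rewrite normrM normrZ ler_wpM2l//.
rewrite -[xpart _ - _]opprB dotNr normrN; apply: le_trans (hd1 _ _ xix zx) _.
by rewrite mul1r.
Unshelve. all: by end_near. Qed.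

End MaximumFilter.
End MaximumPoints.

(** * The upper half-relaxed limit is a subsolution *)
Section Subsolution.
Variables (R : realType) (N : nat) (Omega : set 'rV[R]_N).
Hypothesis Omega_bounded : bounded_set Omega.
Variables (gp gm : 'rV[R]_N -> R).
Hypotheses (gp_cont : continuous gp) (gm_cont : continuous gm).
Hypothesis hg : forall x, closure Omega x -> gm x < gp x.
Local Notation D := (closure Omega).
Local Notation K := (fun e => closure (thin Omega gp gm e)).
Variable F : 'M[R]_(N + 1) -> 'rV[R]_(N + 1) -> R -> 'rV[R]_N -> R -> R.
Hypothesis hF : {within @symmx R (N + 1) `*` setT `*` setT `*` D `*` `[-1, 1],
  continuous (fun t : 'M[R]_(N + 1) * 'rV[R]_(N + 1) * R * 'rV[R]_N * R =>
    let: (X, p, r, x, y) := t in F X p r x y)}.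
Variables (gamma1p gamma1m : 'rV[R]_N -> R -> 'rV[R]_N).
Variables (betap betam : 'rV[R]_N -> R -> R).
Variables (go : 'rV[R]_N -> 'rV[R]_N) (bo : 'rV[R]_N -> R).
Hypotheses (go_C1 : C1v go) (bo_C1 : C1 bo).
Variables (kp km : 'rV[R]_N -> 'rV[R]_N) (lp lm : 'rV[R]_N -> R).
Hypotheses (hkp : {within D, continuous kp}) (hkm : {within D, continuous km}).
Hypotheses (hlp : {within D, continuous lp}) (hlm : {within D, continuous lm}).
Hypothesis gamma1p_exp : forall d : R, 0 < d ->
  \forall y \near (0 : R), forall x, D x ->
    `|gamma1p x y - (go x + y *: kp x)| <= d * `|y|.
Hypothesis gamma1m_exp : forall d : R, 0 < d ->
  \forall y \near (0 : R), forall x, D x ->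
    `|gamma1m x y - (- go x + y *: km x)| <= d * `|y|.
Hypothesis betap_exp : forall d : R, 0 < d ->
  \forall y \near (0 : R), forall x, D x ->
    `|betap x y - (bo x + lp x * y)| <= d * `|y|.
Hypothesis betam_exp : forall d : R, 0 < d ->
  \forall y \near (0 : R), forall x, D x ->
    `|betam x y - (- bo x + lm x * y)| <= d * `|y|.
Variables (nu : 'rV[R]_N -> 'rV[R]_N) (L : lateral R N).
Variable beta : 'rV[R]_N -> R -> R.
Hypothesis hbeta : {within bdry Omega `*` `[-1, 1],
  continuous (fun t : 'rV[R]_N * R => beta t.1 t.2)}.
Hypothesis hL : lateral_admissible Omega nu L.
Variables (u : R -> 'rV[R]_(N + 1) -> R) (C e1 : R).
Hypothesis e1_gt0 : 0 < e1.
Hypothesis u_bounded : forall (e : R) z, 0 < e < e1 -> K e z -> `|u e z| <= C.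
Hypothesis e1_thin : forall e : R, 0 < e < e1 ->
  forall z, K e z -> D (xpart z) /\ -1 <= ypart z <= 1.
Hypothesis u_sub : forall e : R, 0 < e < e1 -> visc_sub (K e)
  (Peps_sub_cond Omega gp gm F gamma1p gamma1m betap betam L beta e) (u e).
Local Notation v := (relaxed_limsup K u).
Local Notation env e := (usc_env (K e) (u e)).
Local Notation Mlim := (limit_mx gp gm go bo kp km lp lm).

Section StrictMax.
Variables (phi : 'rV[R]_N -> R) (k : R) (x0 : 'rV[R]_N).
Hypotheses (phi_C2 : C2 phi) (k_gt0 : 0 < k) (Dx0 : D x0).
Hypothesis strict_max : forall x, D x ->
  v x - phi x <= v x0 - phi x0 - k / 2 * dot (x - x0) (x - x0).
Let p := grad phi x0.
Let X := hess phi x0.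
Let a x := bo x - dot (go x) (grad phi x).

Let a_C1 : C1 a.
Proof.
by apply: C1D; [exact: bo_C1|exact/C1N/(C1_dot go_C1 (C1v_grad phi_C2))].
Qed.

Let grad_a : grad a x0 = slope_grad go bo X p x0.
Proof.
have C1d : C1 (fun x => dot (go x) (grad phi x)).
  exact: C1_dot go_C1 (C1v_grad phi_C2).
rewrite /a (gradD x0 bo_C1 (C1N C1d)).
rewrite (gradN x0 C1d) (grad_dot x0 go_C1 (C1v_grad phi_C2)) (Dmx_grad x0 phi_C2).
by rewrite [_ *m hess _ _ + _]addrC.
Qed.

Let q := grad a x0.
(* [Lp + s] and [Lm - s] are the limits of the first-order terms at the top and
   at the bottom face.  By the choice of [m] their sum is [k] times the height
   [gp x0 - gm x0], and [s] makes them equal. *)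
Let m := vertical_hess gp gm go bo kp km lp lm X p x0 + k.
Let Lp := gp x0 * (dot (kp x0) p + (dot (go x0) q + m) - lp x0).
Let Lm := gm x0 * (dot (km x0) p - (dot (go x0) q + m) - lm x0).
Let s := (Lm - Lp) / 2.

Let gpm_gt0 : 0 < gp x0 - gm x0.
Proof. by rewrite subr_gt0; exact: hg. Qed.

Let LpLm : Lp + Lm = (gp x0 - gm x0) * k.
Proof.
rewrite /Lp /Lm /m /q grad_a /vertical_hess.
set w := dot (go x0) _; move: (gpm_gt0); rewrite lt0r => /andP[g0 _].
by field.
Qed.

Let Lp_gt0 : 0 < Lp + s.
Proof.
have -> : Lp + s = (Lp + Lm) / 2 by rewrite /s; field.
by rewrite LpLm divr_gt0// mulr_gt0.
Qed.

Let Lm_gt0 : 0 < Lm - s.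
Proof.
have -> : Lm - s = (Lp + Lm) / 2 by rewrite /s; field.
by rewrite LpLm divr_gt0// mulr_gt0.
Qed.

Let phi_cont : continuous phi.
Proof. by have [/C1_continuous] := phi_C2. Qed.

Local Notation G := (maxima_filter Omega gp gm u phi a k m s x0).

#[local] Instance G_proper : ProperFilter G.
Proof.
exact: (maxima_filter_proper Omega_bounded gp_cont gm_cont hg e1_gt0 u_bounded
  e1_thin m s phi_cont a_C1 k_gt0 Dx0 strict_max).
Qed.

Let e_cvg := maxima_e_cvg Omega_bounded gp_cont gm_cont hg e1_gt0 u_bounded
  e1_thin m s phi_cont a_C1 k_gt0 Dx0 strict_max.
Let x_cvg := maxima_x_cvg Omega_bounded gp_cont gm_cont hg e1_gt0 u_bounded
  e1_thin m s phi_cont a_C1 k_gt0 Dx0 strict_max.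
Let r_cvg := maxima_env_cvg Omega_bounded gp_cont gm_cont hg e1_gt0 u_bounded
  e1_thin m s phi_cont a_C1 k_gt0 Dx0 strict_max.
Let h_cvg := maxima_h_cvg Omega_bounded gp_cont gm_cont hg e1_gt0 u_bounded
  e1_thin m s phi_cont a_C1 k_gt0 Dx0 strict_max.
Let d_cvg := maxima_diff_cvg Omega_bounded gp_cont gm_cont hg e1_gt0 u_bounded
  e1_thin m s phi_cont a_C1 k_gt0 Dx0 strict_max.
Let e_small : \forall t \near G, 0 < t.1.1 < e1.
Proof. exact: maxima_e1. Qed.

Let Kz : \forall t \near G, K t.1.1 t.1.2.
Proof. exact: maxima_K. Qed.

Let Dx_near : \forall t \near G, D (xpart t.1.2).
Proof.
near=> t; have e0 : 0 < t.1.1 < e1 by near: t; exact: e_small.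
have Kt : K t.1.1 t.1.2 by near: t; exact: Kz.
by have [] := e1_thin e0 Kt.
Unshelve. all: by end_near. Qed.

Let e_gt0 : \forall t \near G, 0 < t.1.1.
Proof.
near=> t; have /andP[] : 0 < t.1.1 < e1 by near: t; exact: e_small.
by [].
Unshelve. all: by end_near. Qed.

Let p_cvg : grad phi (xpart t.1.2) @[t --> G] --> grad phi x0.
Proof. by apply: cvg_comp x_cvg _; apply: grad_continuous; have [] := phi_C2. Qed.

Let go_cvg : go (xpart t.1.2) @[t --> G] --> go x0.
Proof. by apply: cvg_comp x_cvg _; exact: C1v_continuous. Qed.

Lemma top_strict : \forall t \near G,
   betap (xpart t.1.2) (t.1.1 * gp (xpart t.1.2)) <
   dot (gamma1p (xpart t.1.2) (t.1.1 * gp (xpart t.1.2)))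
     (grad phi (xpart t.1.2) + k *: (xpart t.1.2 - t.2)
      + (t.1.1 * gp (xpart t.1.2)) *: q) +
   1 * (a t.2 + dot q (xpart t.1.2 - t.2) + m * (t.1.1 * gp (xpart t.1.2))
        + t.1.1 * s).
Proof.
apply: (@boundary_expansion _ _ D _ G _ _ _ _ x0 e_cvg e_gt0 Dx_near h_cvg
  1 k m s q gp a bo lp go kp (grad phi) gamma1p betap) => //.
- by apply: cvg_comp x_cvg _; exact: gp_cont.
- exact: within_cvg hlp Dx0 x_cvg Dx_near.
- exact: within_cvg hkp Dx0 x_cvg Dx_near.
- by move=> d /gamma1p_exp; apply: filterS => y h x Dx; rewrite scale1r; exact: h.
- by move=> d /betap_exp; apply: filterS => y h x Dx; rewrite mul1r; exact: h.
- by rewrite !mul1r.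
Qed.

Lemma bottom_strict : \forall t \near G,
   betam (xpart t.1.2) (t.1.1 * gm (xpart t.1.2)) <
   dot (gamma1m (xpart t.1.2) (t.1.1 * gm (xpart t.1.2)))
     (grad phi (xpart t.1.2) + k *: (xpart t.1.2 - t.2)
      + (t.1.1 * gm (xpart t.1.2)) *: q) +
   -1 * (a t.2 + dot q (xpart t.1.2 - t.2) + m * (t.1.1 * gm (xpart t.1.2))
        + t.1.1 * s).
Proof.
apply: (@boundary_expansion _ _ D _ G _ _ _ _ x0 e_cvg e_gt0 Dx_near h_cvg
  (-1) k m s q gm a bo lm go km (grad phi) gamma1m betam) => //.
- by apply: cvg_comp x_cvg _; exact: gm_cont.
- exact: within_cvg hlm Dx0 x_cvg Dx_near.
- exact: within_cvg hkm Dx0 x_cvg Dx_near.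
- by move=> d /gamma1m_exp; apply: filterS => y h x Dx; rewrite scaleN1r; exact: h.
- by move=> d /betam_exp; apply: filterS => y h x Dx; rewrite mulN1r; exact: h.
- by rewrite !mulN1r.
Qed.

(** If both alternatives failed in the limit, then near the limit the equation
    and the lateral condition would fail at the maximum points, while the
    expansions exclude the conditions at the two faces: no alternative would be
    left in the definition of a subsolution. *)
Lemma strict_max_limit :
  F (Mlim X p x0 + k%:M) (row_mx p (a x0)%:M) (v x0) x0 0 <= 0 \/
  bdry Omega x0 /\ lateral_sub L beta p (v x0) x0.
Proof.
have ME : Mlim X p x0 + k%:M = block_mx (X + k%:M) q^T q m%:M.
  rewrite limit_mxE ?(scalar_mx_block N 1) ?add_block_mx ?addr0; last exact: hess_sym.
  by rewrite -scalar_mx1D -grad_a.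
rewrite ME; apply: contrapT => no.
have F_pos : 0 < F (block_mx (X + k%:M) q^T q m%:M) (row_mx p (a x0)%:M) (v x0) x0 0.
  by rewrite ltNge; apply/negP => Fle; apply: no; left.
have nlat : ~ (bdry Omega x0 /\ lateral_sub L beta p (v x0) x0).
  by move=> h; apply: no; right.
have int_near := interior_limit gp_cont gm_cont Omega_bounded e1_thin s phi_C2
  (C1_continuous a_C1) Dx0 e_cvg e_small Kz x_cvg h_cvg r_cvg hF F_pos.
have lat_near := lateral_limit gp_cont gm_cont Omega_bounded e1_thin k m s q
  phi_C2 (C1_continuous a_C1) e_cvg e_small Kz x_cvg h_cvg r_cvg
  (beta := beta) hbeta hL nlat.
have {}int_near := int_near G_proper.
have {}lat_near := lat_near G_proper.
have top := top_strict; have bot := bottom_strict.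
have mx1 : \forall t \near G, maxima Omega gp gm u phi a k m s x0 1 t.
  exact: maxima_near.
suff : \forall t \near G, False by move=> /filter_ex[].
near=> t.
have et : 0 < t.1.1 < e1 by near: t; exact: e_small.
have [_ Kt _ [_ _ _ mx]] : maxima Omega gp gm u phi a k m s x0 1 t by near: t.
have [_ /(_ (layer_test phi a k m s q t.1.1 t.2) t.1.2)] := u_sub et.
rewrite hess_layer_test// grad_layer_test//.
have test_max w : K t.1.1 w ->
    env t.1.1 w - layer_test phi a k m s q t.1.1 t.2 w <=
    env t.1.1 t.1.2 - layer_test phi a k m s q t.1.1 t.2 t.1.2.
  have Dt : D t.2 by near: t; apply: (@maxima_near _ _ _ _ _ _ _ _ _ _ _ _ 1) => // t [].
  by move=> Kw; have := mx w t.2 Kw Dt; rewrite !penalisedE !opprD !addrA lerD2r.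
move=> /(_ (C2_layer_test _ _ _ _ _ phi_C2 _ _) Kt test_max) [].
- by apply/negP; rewrite -ltNge; near: t; exact: int_near.
- by near: t; exact: lat_near.
- move=> [[_ ->]]; rewrite dot_row_mx; apply/negP; rewrite -ltNge.
  by near: t; exact: top.
- move=> [[_ ->]]; rewrite dot_row_mx; apply/negP; rewrite -ltNge.
  by near: t; exact: bot.
Unshelve. all: by end_near. Qed.

End StrictMax.

Lemma limit_mx_sym X p x : symmx X -> symmx (Mlim X p x).
Proof.
by move=> sX; rewrite limit_mxE// /symmx /= tr_block_mx trmxK sX tr_scalar_mx.
Qed.

(** The direction in which the matrix argument of [F] moves when the maximum is
    made strict by the addition of [k |x - x0|^2 / 2] to [phi] and the Hessian
    of the penalty is added. *)
Definition shift_mx x : 'M[R]_(N + 1) :=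
  block_mx 1%:M (- (go x)^T) (- go x) (go x *m (go x)^T) + 1%:M.

Lemma shift_mx_sym x : symmx (shift_mx x).
Proof.
rewrite /symmx /shift_mx /= linearD /= tr_block_mx !tr_scalar_mx.
by rewrite !linearN /= trmxK trmx_mul trmxK.
Qed.

Lemma limit_mx_shift X p x (k : R) :
  Mlim (X + k%:M) p x + k%:M = Mlim X p x + k *: shift_mx x.
Proof.
rewrite /limit_mx /shift_mx; set B2 := block_mx 0 _ _ _; set B3 := block_mx 0 _ _ _.
have -> : block_mx (X + k%:M) (- ((X + k%:M) *m (go x)^T)) (- (go x *m (X + k%:M)))
     (go x *m (X + k%:M) *m (go x)^T) =
   block_mx X (- (X *m (go x)^T)) (- (go x *m X)) (go x *m X *m (go x)^T) +
   k *: block_mx 1%:M (- (go x)^T) (- go x) (go x *m (go x)^T).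
  rewrite scale_block_mx add_block_mx scale_scalar_mx mulr1 mulmxDl mulmxDr mulmxDl.
  by rewrite mul_scalar_mx mul_mx_scalar -scalemxAl !scalerN !opprD.
rewrite [k *: (_ + _)]scalerDr scale_scalar_mx mulr1 -!addrA; congr (_ + _).
by rewrite addrCA; congr (_ + _); rewrite addrCA.
Qed.

Lemma limit_op_shift_le0 phi x0 : C2 phi -> D x0 ->
  (forall x, D x -> v x - phi x <= v x0 - phi x0) ->
  ~ (bdry Omega x0 /\ lateral_sub L beta (grad phi x0) (v x0) x0) ->
  forall k : R, 0 < k ->
  F (Mlim (hess phi x0) (grad phi x0) x0 + k *: shift_mx x0)
    (row_mx (grad phi x0) (bo x0 - dot (go x0) (grad phi x0))%:M) (v x0) x0 0 <= 0.
Proof.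
move=> phi_C2 Dx0 hmax nlat k k0.
have symk : symmx (k%:M : 'M[R]_N) by rewrite /symmx /= tr_scalar_mx.
have quad_C2 := C2_quad (- k *: x0) symk.
pose psi x := phi x + quad (- k *: x0) k%:M x.
have psi_C2 : C2 psi by exact: C2D.
have psi_max x : D x ->
    v x - psi x <= v x0 - psi x0 - k / 2 * dot (x - x0) (x - x0).
  by move=> /hmax; rewrite /psi !quad_scalar subrr dot0l; lra.
have gradE : grad psi x0 = grad phi x0.
  have [[C1phi _] [C1q _]] := (phi_C2, quad_C2).
  rewrite /psi (gradD x0 C1phi C1q) (grad_quad _ symk) mul_mx_scalar scaleNr.
  by rewrite addNr addr0.
have hessE' : hess psi x0 = hess phi x0 + k%:M.
  by rewrite /psi (hessD x0 phi_C2 quad_C2) (hess_quad _ symk).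
have := strict_max_limit psi_C2 k0 Dx0 psi_max.
by rewrite gradE hessE' limit_mx_shift => -[].
Qed.

(** The maximum is made strict at the price of the perturbation [shift_mx],
    which disappears as [k] tends to 0. *)
Lemma relaxed_limsup_sub :
  P0_sub Omega (limit_op gp gm F go bo kp km lp lm) L beta v.
Proof.
have thin_ne := thin_meets_columns hg.
have vE x : D x -> usc_env D v x = v x.
  exact: (relaxed_limsup_env thin_ne e1_gt0 u_bounded).
split.
  exists C; split; first exact: num_real.
  move=> C' CC' _ [x Dx <-]; apply: le_trans (ltW CC').
  exact: (relaxed_limsup_bounded thin_ne e1_gt0 u_bounded).
move=> phi x0 phi_C2 Dx0 hmax.
have {}hmax x : D x -> v x - phi x <= v x0 - phi x0.
  by move=> Dx; have := hmax x Dx; rewrite !vE.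
rewrite vE// limit_opE.
have [lat|nlat] := pselect (bdry Omega x0 /\
  lateral_sub L beta (grad phi x0) (v x0) x0);
  first by right.
left; have Fk := limit_op_shift_le0 phi_C2 Dx0 hmax nlat.
set M0 := Mlim _ _ _ in Fk *.
pose Mk (k : R) := M0 + k *: shift_mx x0.
have FG : Filter (0 : R)^'+ by typeclasses eauto.
have M_cvg : Mk k @[k --> 0^'+] --> M0.
  rewrite -[X in _ --> X]addr0 -(scale0r (shift_mx x0)).
  apply: cvgD; first exact: cvg_cst.
  by apply: cvgZ; [exact: cvg_within|exact: cvg_cst].
have sMk k : symmx (Mk k).
  rewrite /symmx /Mk /= linearD /= linearZ /= shift_mx_sym.
  by rewrite (limit_mx_sym _ _ (hess_sym x0 phi_C2)).
pose P0 : 'rV[R]_(N + 1) :=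
  row_mx (grad phi x0) (bo x0 - dot (go x0) (grad phi x0))%:M.
have cst_cvg (V : topologicalType) (c : V) : cst c k @[k --> (0 : R)^'+] --> c.
  exact: cvg_cst.
have t_cvg := cvg_pair_nbhs FG (cvg_pair_nbhs FG (cvg_pair_nbhs FG
  (cvg_pair_nbhs FG M_cvg (cst_cvg _ P0)) (cst_cvg _ (v x0))) (cst_cvg _ x0))
  (cst_cvg _ (0 : R)).
have inS k : (@symmx R (N + 1) `*` setT `*` setT `*` D `*` `[-1, 1])
    (Mk k, P0, v x0, x0, 0 : R).
  split; last by rewrite /= in_itv /= oppr_le0 ler01.
  by split => //; split => //; split => //; exact: sMk.
have in0 : (@symmx R (N + 1) `*` setT `*` setT `*` D `*` `[-1, 1])
    (M0, P0, v x0, x0, 0 : R).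
  by have := inS 0; rewrite /Mk scale0r addr0.
have F_cvg := within_cvg FG hF in0 t_cvg (nearW FG inS).
apply: (cvgr_to_le F_cvg); near=> k; apply: Fk.
by near: k; exact: nbhs_right_gt.
Unshelve. all: by end_near. Qed.

End Subsolution.

(** * Reflection: from subsolutions to supersolutions *)
Lemma cvg_fst_nbhs (U V : topologicalType) (I : Type) (G : set_system I)
    (f : I -> U * V) (a : U * V) : f @ G --> a -> (f i).1 @[i --> G] --> a.1.
Proof.
move=> fa P Pa; apply: (fa [set t | P t.1]).
by exists (P, setT) => [|[x y] []//]; split => //; exact: filterT.
Qed.

Lemma cvg_snd_nbhs (U V : topologicalType) (I : Type) (G : set_system I)
    (f : I -> U * V) (a : U * V) : f @ G --> a -> (f i).2 @[i --> G] --> a.2.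
Proof.
move=> fa P Pa; apply: (fa [set t | P t.2]).
by exists (setT, P) => [|[x y] []//]; split => //; exact: filterT.
Qed.

Section Negation.
Variables (R : realType) (N : nat).

Lemma bounded_setN (n : nat) (K : set 'rV[R]_n) (u : 'rV[R]_n -> R) :
  bounded_set (u @` K) -> bounded_set ((fun z => - u z) @` K).
Proof.
move=> [M [Mr hM]]; exists M; split => // M' MM' _ [z Kz <-].
by rewrite /= normrN; apply: (hM M' MM'); exists z.
Qed.

Lemma visc_super_opp n (K : set 'rV[R]_n) H (u : 'rV[R]_n -> R) :
  visc_super K H u ->
  visc_sub K (fun X p r z => H (- X) (- p) (- r) z) (fun z => - u z).
Proof.
move=> [bu hu]; split; first exact: bounded_setN.
move=> phi z phi_C2 Kz hmax; have [C1phi _] := phi_C2.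
have := hu _ z (C2N phi_C2) Kz; rewrite (hessN z phi_C2) (gradN z C1phi) !lsc_envE.
by apply => w Kw; rewrite lsc_envE; have := hmax w Kw; lra.
Qed.

Lemma visc_sub_opp n (K : set 'rV[R]_n) H (u : 'rV[R]_n -> R) :
  visc_sub K H u ->
  visc_super K (fun X p r z => H (- X) (- p) (- r) z) (fun z => - u z).
Proof.
move=> [bu hu]; split; first exact: bounded_setN.
have envE z : lsc_env K (fun w => - u w) z = - usc_env K u z.
  by rewrite lsc_envE; congr (- usc_env _ _ _); apply/funext => w; rewrite opprK.
move=> phi z phi_C2 Kz hmin; have [C1phi _] := phi_C2.
have := hu _ z (C2N phi_C2) Kz; rewrite (hessN z phi_C2) (gradN z C1phi).
rewrite envE (opprK (usc_env K u z)); apply => w Kw; have := hmin w Kw; rewrite !envE; lra.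
Qed.

Lemma visc_subS n (K : set 'rV[R]_n) H H' (u : 'rV[R]_n -> R) :
  (forall X p r z, H X p r z -> H' X p r z) -> visc_sub K H u -> visc_sub K H' u.
Proof. by move=> HH' [bu hu]; split=> // phi z *; exact/HH'/hu. Qed.

Lemma visc_superS n (K : set 'rV[R]_n) H H' (u : 'rV[R]_n -> R) :
  (forall X p r z, H X p r z -> H' X p r z) ->
  visc_super K H u -> visc_super K H' u.
Proof. by move=> HH' [bu hu]; split=> // phi z *; exact/HH'/hu. Qed.

(** The operator satisfied by [- u] when [u] satisfies [F]. *)
Definition opp_op (F : 'M[R]_(N + 1) -> 'rV[R]_(N + 1) -> R -> 'rV[R]_N -> R -> R)
    X p r x y := - F (- X) (- p) (- r) x y.

Lemma opp_op_continuous (D : set 'rV[R]_N) (J : set R) F :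
  {within @symmx R (N + 1) `*` setT `*` setT `*` D `*` J,
    continuous (fun t : 'M[R]_(N + 1) * 'rV[R]_(N + 1) * R * 'rV[R]_N * R =>
      let: (X, p, r, x, y) := t in F X p r x y)} ->
  {within @symmx R (N + 1) `*` setT `*` setT `*` D `*` J,
    continuous (fun t : 'M[R]_(N + 1) * 'rV[R]_(N + 1) * R * 'rV[R]_N * R =>
      let: (X, p, r, x, y) := t in opp_op F X p r x y)}.
Proof.
move=> hF; pose T := ('M[R]_(N + 1) * 'rV[R]_(N + 1) * R * 'rV[R]_N * R)%type.
set A := _ `*` J in hF *.
pose opp (t : T) : T := (- t.1.1.1.1, - t.1.1.1.2, - t.1.1.2, t.1.2, t.2).
have opp_A t : A t -> A (opp t).
  move=> [[[[sX _] _] Dx] Jy]; split => //; split => //; split => //; split => //.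
  have tX : t.1.1.1.1^T = t.1.1.1.1 by exact: sX.
  by rewrite /symmx /= linearN /= tX.
apply/subspace_continuousP => t0 At0.
have FW : Filter (within A (nbhs t0)) by exact: within_filter.
have c0 : id @ within A (nbhs t0) --> t0 by exact: cvg_within.
have c1 := cvg_fst_nbhs c0; have c2 := cvg_fst_nbhs c1.
have c3 := cvg_fst_nbhs c2; have c4 := cvg_fst_nbhs c3.
have opp_cvg := cvg_pair_nbhs FW (cvg_pair_nbhs FW (cvg_pair_nbhs FW
  (cvg_pair_nbhs FW (cvgN c4) (cvgN (cvg_snd_nbhs c3)))
  (cvgN (cvg_snd_nbhs c2))) (cvg_snd_nbhs c1)) (cvg_snd_nbhs c0).
have {}opp_cvg := opp_cvg FW FW FW.
have nA : \forall t \near within A (nbhs t0), A (opp t).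
  by apply: filterS (withinT A (nbhs_filter t0)) => t; exact: opp_A.
have F_cvg := cvgN (within_cvg FW hF (opp_A _ At0) opp_cvg nA).
have {}F_cvg := F_cvg FW.
have FE : (fun t : T => let: (X, p, r, x, y) := t in opp_op F X p r x y) =
    - (fun t : T => let: (X, p, r, x, y) := opp t in F X p r x y).
  by apply/funext => -[[[[X p] r] x] y].
by rewrite FE; exact: F_cvg.
Qed.

Lemma Peps_super_opp Omega gp gm F g1p g1m bp bm L beta e X p r z :
  Peps_super_cond Omega gp gm F g1p g1m bp bm L beta e (- X) (- p) (- r) z ->
  Peps_sub_cond Omega gp gm (opp_op F) g1p g1m (fun x y => - bp x y)
    (fun x y => - bm x y) L (fun x y => - beta x y) e X p r z.
Proof.
case=> [F0|[lat cond]|[top cond]|[bot cond]].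
- by apply: Or41; rewrite /opp_op oppr_le0.
- apply: Or42; split => //; case: L cond => [g1 g2|]; last by rewrite lerNr.
  by rewrite dotNr lerNr.
- by apply: Or43; split => //; move: cond; rewrite dotNr lerNr.
- by apply: Or44; split => //; move: cond; rewrite dotNr lerNr.
Qed.

Lemma limit_mx_opp (gp gm : 'rV[R]_N -> R) go (bo : 'rV[R]_N -> R) kp km lp lm X p x :
  C1 bo ->
  limit_mx gp gm go (fun x => - bo x) kp km (fun x => - lp x) (fun x => - lm x)
    (- X) (- p) x = - limit_mx gp gm go bo kp km lp lm X p x.
Proof.
move=> C1bo; rewrite /limit_mx !opprD !opp_block_mx (gradN x C1bo) !oppr0.
congr (block_mx _ _ _ _ + block_mx _ _ _ _ + block_mx _ _ _ _).
- by rewrite mulNmx.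
- by rewrite mulmxN.
- by rewrite mulmxN mulNmx.
- by rewrite mulNmx linearN.
- by rewrite mulNmx.
- by rewrite dotNr raddfN.
- by rewrite linearN.
- by rewrite -raddfN /=; congr _%:M; rewrite dotNr; ring.
Qed.

Lemma limit_op_opp (gp gm : 'rV[R]_N -> R) F go (bo : 'rV[R]_N -> R) kp km lp lm
    X p r x : C1 bo ->
  limit_op gp gm (opp_op F) go (fun x => - bo x) kp km (fun x => - lp x)
    (fun x => - lm x) (- X) (- p) (- r) x =
  - limit_op gp gm F go bo kp km lp lm X p r x.
Proof.
move=> C1bo; rewrite !limit_opE limit_mx_opp// /opp_op !opprK opp_row_mx opprK.
by rewrite dotNr opprK -raddfN /= opprD !opprK.
Qed.

End Negation.

(** * Agreement of the half-relaxed limits and uniform convergence *)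
Section UniformConvergence.
Variables (R : realType) (N : nat).

Lemma visc_super_eq n (K : set 'rV[R]_n) H (u w : 'rV[R]_n -> R) :
  (forall z, K z -> u z = w z) ->
  (forall z, K z -> lsc_env K u z = lsc_env K w z) ->
  visc_super K H u -> visc_super K H w.
Proof.
move=> uw lscE [bu hu]; split.
  suff -> : w @` K = u @` K by [].
  by apply/seteqP; split => _ [z Kz <-]; exists z => //; rewrite uw.
move=> phi z phi_C2 Kz hmin; have := hu phi z phi_C2 Kz; rewrite lscE//.
by apply => y Ky; rewrite lscE//; exact: hmin.
Qed.

Variables (D : set 'rV[R]_N) (K : R -> set 'rV[R]_(N + 1)).
Hypothesis thin_ne : forall x (d : R), D x -> 0 < d -> exists (e : R) z,
  [/\ 0 < e < d, K e z & `|xpart z - x| < d].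
Variables (u : R -> 'rV[R]_(N + 1) -> R) (C e1 : R).
Hypothesis e1_gt0 : 0 < e1.
Hypothesis u_bounded : forall (e : R) z, 0 < e < e1 -> K e z -> `|u e z| <= C.
Hypothesis compD : compact D.
Hypothesis xpartK : forall (e : R) z, 0 < e < e1 -> K e z -> D (xpart z).

Local Notation un := (fun e z => - u e z).
Local Notation v := (relaxed_limsup K u).
Local Notation vn := (relaxed_limsup K un).

Lemma opp_bounded (e : R) z : 0 < e < e1 -> K e z -> `|un e z| <= C.
Proof. by move=> ee Kz; rewrite normrN; exact: u_bounded. Qed.

(** In this section [- vn] is the lower half-relaxed limit of [u].  Both limits
    are approached by values of [u] over the same points near [x]. *)
Lemma relaxed_liminf_le_limsup x : D x -> - vn x <= v x.
Proof.
move=> Dx; apply/ler_addgt0Pr => d d0; have d20 : 0 < d / 2 by rewrite divr_gt0.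
have vd : v x < v x + d / 2 by rewrite ltrDl.
have vnd : vn x < vn x + d / 2 by rewrite ltrDl.
have [e [z [_ [a b]]]] := near_thin_ex thin_ne Dx (near_thinI
  (relaxed_limsup_lt e1_gt0 u_bounded vd) (relaxed_limsup_lt e1_gt0 opp_bounded vnd)).
lra.
Qed.

Hypothesis limits_agree : forall x, D x -> v x = - vn x.

(** Near [x], [u] is close to the common value of the two limits at [x]; this
    value is close to the one at nearby points because [v] and [vn] are both
    upper semicontinuous and [v = - vn]. *)
Lemma relaxed_limit_uniform (d : R) : 0 < d -> exists2 d' : R, 0 < d' &
  forall (e : R) z, 0 < e < d' -> K e z -> `|u e z - v (xpart z)| <= d.
Proof.
move=> d0; have d20 : 0 < d / 2 by rewrite divr_gt0.
have [d' d'0 h] : exists2 d' : R, 0 < d' & forall (e : R) z, 0 < e < d' ->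
    K e z -> D (xpart z) -> D (xpart z) -> `|u e z - v (xpart z)| <= d.
  apply: near_thin_compact => // x Dx.
  have vd : v x < v x + d / 2 by rewrite ltrDl.
  have vnd : vn x < vn x + d / 2 by rewrite ltrDl.
  have A := near_thinI (relaxed_limsup_lt e1_gt0 u_bounded vd)
    (relaxed_limsup_lt e1_gt0 opp_bounded vnd).
  have B := near_thinI
    (near_thin_xpart K (relaxed_limsup_usc thin_ne e1_gt0 u_bounded Dx vd))
    (near_thin_xpart K (relaxed_limsup_usc thin_ne e1_gt0 opp_bounded Dx vnd)).
  apply: near_thinS (near_thinI A B) => e z Kz [[a b] [c c']] Dz.
  have {}c := c Dz; have {}c' := c' Dz.
  have E := limits_agree Dx; have E' := limits_agree Dz.
  by rewrite ler_norml; lra.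
exists (Num.min d' e1); first by rewrite lt_min d'0.
move=> e z; rewrite lt_min => /andP[e0 /andP[ed ee1]] Kz.
have Dz : D (xpart z) by apply: xpartK Kz; rewrite e0.
by apply: h => //; rewrite e0.
Qed.

Lemma relaxed_limit_lsc_env x : D x -> lsc_env D (fun x => - vn x) x = lsc_env D v x.
Proof.
move=> Dx; rewrite !lsc_envE.
have -> : (fun w => - - vn w) = vn by apply/funext => w; rewrite opprK.
have vn_usc t : - v x < t -> \forall w \near x, D w -> - v w < t.
  rewrite (limits_agree Dx) (opprK (vn x)) => vt.
  have := relaxed_limsup_usc thin_ne e1_gt0 opp_bounded Dx vt.
  by apply: near_mxS => w h Dw; rewrite (limits_agree Dw) (opprK (vn w)); exact: h.
rewrite (relaxed_limsup_env thin_ne e1_gt0 opp_bounded Dx).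
by rewrite (usc_env_id Dx vn_usc) (opprK (v x)) (limits_agree Dx).
Qed.

End UniformConvergence.

Lemma cvg0_ereal_sup (R : realType) (T : Type) (K : R -> set T) (f : R -> T -> R) :
  (forall e : R, 0 < e -> K e !=set0) ->
  (forall d : R, 0 < d -> exists2 d' : R, 0 < d' &
    forall (e : R) z, 0 < e < d' -> K e z -> `|f e z| <= d) ->
  ereal_sup [set `|f e z|%:E | z in K e] @[e --> 0^'+] --> 0%E.
Proof.
move=> K_ne small; pose S e := ereal_sup [set `|f e z|%:E | z in K e].
have S_ge0 e : 0 < e -> (0 <= S e)%E.
  move=> /K_ne[z Kz]; apply: (@le_trans _ _ `|f e z|%:E); first by rewrite lee_fin.
  by apply: ereal_sup_ubound; exists z.
have S_le d : 0 < d -> \forall e \near (0 : R)^'+, (0 <= S e <= d%:E)%E.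
  move=> d0; have [d' d'0 h] := small d d0.
  near=> e; have e0 : 0 < e by near: e; exact: nbhs_right_gt.
  rewrite S_ge0//=; apply: ge_ereal_sup => _ [z Kz <-]; rewrite lee_fin; apply: h => //.
  by rewrite e0 /=; near: e; exact: nbhs_right_lt.
have S_fin e (d : R) : (0 <= S e <= d%:E)%E -> S e \is a fin_num.
  move=> /andP[S0 Sd]; rewrite fin_real// (lt_le_trans _ S0) ?ltNyr//.
  by rewrite (le_lt_trans Sd) ?ltry.
apply/fine_cvgP; split.
  by apply: filterS (S_le _ ltr01) => e; exact: S_fin.
apply/cvgr0Pnorm_le => d d0; apply: filterS (S_le _ d0) => e Sd /=.
rewrite -lee_fin; have Sf := S_fin _ _ Sd; case/andP: Sd => S0 Sd.
by rewrite ger0_norm ?fine_ge0// fineK.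
Unshelve. all: by end_near. Qed.

Theorem corollary5 (R : realType) (N : nat) (hN : (1 <= N)%N)
  (Omega : set 'rV[R]_N) (nu : 'rV[R]_N -> 'rV[R]_N)
  (hOmega : bounded_domain Omega)
  (hbdry : C1_boundary Omega)
  (hnu : outward_unit_normal Omega nu)
  (gp gm : 'rV[R]_N -> R)
  (hgp : C1 gp) (hgm : C1 gm)
  (hg : forall x, closure Omega x -> gm x < gp x)
  (F : 'M[R]_(N + 1) -> 'rV[R]_(N + 1) -> R -> 'rV[R]_N -> R -> R)
  (hF : {within @symmx R (N + 1) `*` setT `*` setT `*` closure Omega
                `*` `[-1, 1],
    continuous (fun t : 'M[R]_(N + 1) * 'rV[R]_(N + 1) * R * 'rV[R]_N * R =>
      let: (X, p, r, x, y) := t in F X p r x y)})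
  (alpha : R) (halpha : 0 < alpha)
  (hmono : forall (p : 'rV[R]_(N + 1)) (x : 'rV[R]_N) (y : R),
    closure Omega x -> -1 <= y <= 1 ->
    forall (X Y : 'M[R]_(N + 1)) (r s : R),
      symmx X -> symmx Y -> psd_le Y X -> r <= s ->
      F X p r x y - alpha * r <= F Y p s x y - alpha * s)
  (gamma1p gamma1m : 'rV[R]_N -> R -> 'rV[R]_N)
  (betap betam : 'rV[R]_N -> R -> R)
  (hgamma1p : {within closure Omega `*` `[-1, 1],
    continuous (fun t : 'rV[R]_N * R => gamma1p t.1 t.2)})
  (hgamma1m : {within closure Omega `*` `[-1, 1],
    continuous (fun t : 'rV[R]_N * R => gamma1m t.1 t.2)})
  (hbetap : {within closure Omega `*` `[-1, 1],
    continuous (fun t : 'rV[R]_N * R => betap t.1 t.2)})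
  (hbetam : {within closure Omega `*` `[-1, 1],
    continuous (fun t : 'rV[R]_N * R => betam t.1 t.2)})
  (gammao : 'rV[R]_N -> 'rV[R]_N) (betao : 'rV[R]_N -> R)
  (hgammao : C1v gammao) (hbetao : C1 betao)
  (hgamma0 : forall x, closure Omega x ->
    gamma1p x 0 = gammao x /\ - gamma1m x 0 = gammao x)
  (hbeta0 : forall x, closure Omega x ->
    betap x 0 = betao x /\ - betam x 0 = betao x)
  (kp km : 'rV[R]_N -> 'rV[R]_N) (lp lm : 'rV[R]_N -> R)
  (hkp : {within closure Omega, continuous kp})
  (hkm : {within closure Omega, continuous km})
  (hlp : {within closure Omega, continuous lp})
  (hlm : {within closure Omega, continuous lm})
  (hgamma1p_exp : forall d : R, 0 < d ->
    \forall y \near (0 : R), forall x, closure Omega x ->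
      `|gamma1p x y - (gammao x + y *: kp x)| <= d * `|y|)
  (hgamma1m_exp : forall d : R, 0 < d ->
    \forall y \near (0 : R), forall x, closure Omega x ->
      `|gamma1m x y - (- gammao x + y *: km x)| <= d * `|y|)
  (hbetap_exp : forall d : R, 0 < d ->
    \forall y \near (0 : R), forall x, closure Omega x ->
      `|betap x y - (betao x + lp x * y)| <= d * `|y|)
  (hbetam_exp : forall d : R, 0 < d ->
    \forall y \near (0 : R), forall x, closure Omega x ->
      `|betam x y - (- betao x + lm x * y)| <= d * `|y|)
  (L : lateral R N) (beta : 'rV[R]_N -> R -> R)
  (hbeta : {within bdry Omega `*` `[-1, 1],
    continuous (fun t : 'rV[R]_N * R => beta t.1 t.2)})
  (hL : lateral_admissible Omega nu L)
  (eps0 : R) (heps0 : 0 < eps0)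
  (hthin : forall e : R, 0 < e < eps0 ->
    forall z, closure (thin Omega gp gm e) z ->
      closure Omega (xpart z) /\ -1 <= ypart z <= 1)
  (htop : forall e : R, 0 < e < eps0 -> forall z, thin_top Omega gp e z ->
    0 < 1 - e * dot (grad gp (xpart z)) (gamma1p (xpart z) (ypart z)))
  (hbottom : forall e : R, 0 < e < eps0 ->
    forall z, thin_bottom Omega gm e z ->
    0 < 1 + e * dot (grad gm (xpart z)) (gamma1m (xpart z) (ypart z)))
  (hcomparison : forall v w : 'rV[R]_N -> R,
    P0_sub Omega (limit_op gp gm F gammao betao kp km lp lm) L beta v ->
    P0_super Omega (limit_op gp gm F gammao betao kp km lp lm) L beta w ->
    forall x, closure Omega x -> v x <= w x)
  (eps1 : R) (heps1 : 0 < eps1 < eps0)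
  (C0 : R) (hC0 : 0 < C0)
  (u : R -> 'rV[R]_(N + 1) -> R)
  (hu : forall e : R, 0 < e < eps1 ->
    Peps_solution Omega gp gm F gamma1p gamma1m betap betam L beta e (u e))
  (hub : forall e : R, 0 < e < eps1 ->
    (ereal_sup [set `|u e z|%:E | z in closure (thin Omega gp gm e)]
       <= C0%:E)%E) :
  exists u0 : 'rV[R]_N -> R,
    [/\ P0_solution Omega (limit_op gp gm F gammao betao kp km lp lm) L beta u0,
        (forall u1 : 'rV[R]_N -> R,
           P0_solution Omega (limit_op gp gm F gammao betao kp km lp lm) L beta
             u1 ->
           forall x, closure Omega x -> u1 x = u0 x) &
        ereal_sup [set `|u e z - u0 (xpart z)|%:E
                  | z in closure (thin Omega gp gm e)]
          @[e --> 0^'+] --> 0%E].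
Proof.
have [hne _ _ hbd] := hOmega.
have gp_cont := C1_continuous hgp; have gm_cont := C1_continuous hgm.
have [e1_gt0 e10] := andP heps1.
set K := fun e => closure (thin Omega gp gm e).
set D := closure Omega.
have e1_thin (e : R) : 0 < e < eps1 -> forall z, K e z ->
    D (xpart z) /\ -1 <= ypart z <= 1.
  by move=> /andP[e0 ee1]; apply: hthin; rewrite e0 (lt_trans ee1 e10).
have u_bounded (e : R) z : 0 < e < eps1 -> K e z -> `|u e z| <= C0.
  move=> ee Kz; rewrite -lee_fin; apply: le_trans (hub e ee).
  by apply: ereal_sup_ubound; exists z.
have thin_ne := @thin_meets_columns _ _ _ _ _ hg.
have compD : compact D by exact: compact_closure.
have xK (e : R) z : 0 < e < eps1 -> K e z -> D (xpart z).
  by move=> ee Kz; have [] := e1_thin e ee z Kz.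
pose un e z := - u e z.
pose v := relaxed_limsup K u; pose vn := relaxed_limsup K un.
pose G := limit_op gp gm F gammao betao kp km lp lm.
have v_sub : P0_sub Omega G L beta v.
  apply: (relaxed_limsup_sub hbd gp_cont gm_cont hg hF hgammao hbetao
    hkp hkm hlp hlm hgamma1p_exp hgamma1m_exp hbetap_exp hbetam_exp hbeta hL
    e1_gt0 u_bounded e1_thin) => e ee.
  by have [] := hu e ee.
have hbetan : {within bdry Omega `*` `[-1, 1],
    continuous (fun t : 'rV[R]_N * R => - beta t.1 t.2)}.
  by move=> t; apply: cvgN; exact: hbeta.
have hFn : {within @symmx R (N + 1) `*` setT `*` setT `*` closure Omega
                `*` `[-1, 1],
    continuous (fun t : 'M[R]_(N + 1) * 'rV[R]_(N + 1) * R * 'rV[R]_N * R =>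
      let: (X, p, r, x, y) := t in opp_op F X p r x y)}.
  exact: opp_op_continuous hF.
have hlpn : {within closure Omega, continuous (fun x => - lp x)}.
  by move=> x; apply: cvgN; exact: hlp.
have hlmn : {within closure Omega, continuous (fun x => - lm x)}.
  by move=> x; apply: cvgN; exact: hlm.
have hLn : lateral_admissible Omega nu L by [].
have un_bounded := opp_bounded u_bounded.
have vn_sub : P0_sub Omega (limit_op gp gm (opp_op F) gammao (fun x => - betao x)
    kp km (fun x => - lp x) (fun x => - lm x)) L (fun x y => - beta x y) vn.
  apply: (@relaxed_limsup_sub _ _ _ hbd _ _ gp_cont gm_cont hg _ hFn
    gamma1p gamma1m (fun x y => - betap x y) (fun x y => - betam x y)
    gammao _ hgammao (C1N hbetao) kp km _ _ hkp hkm hlpn hlmn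
    hgamma1p_exp hgamma1m_exp _ _ nu L _ hbetan hL un C0 eps1
    e1_gt0 un_bounded e1_thin _) => [d|d|e ee].
  - move=> /hbetap_exp; apply: filterS => y h x Dx; apply: le_trans (h x Dx).
    by rewrite mulNr -!opprD normrN.
  - move=> /hbetam_exp; apply: filterS => y h x Dx; apply: le_trans (h x Dx).
    by rewrite mulNr -!opprD normrN.
  - have [_ u_super] := hu e ee.
    by apply: visc_subS (visc_super_opp u_super) => X p r z; exact: Peps_super_opp.
have vn_super : P0_super Omega G L beta (fun x => - vn x).
  apply: visc_superS (visc_sub_opp vn_sub) => X p r x [Gle|[bx lat]]; [left|right].
    by move: Gle; rewrite limit_op_opp// oppr_le0.
  split => //; case: (L) lat => [g1 g2|]; last by rewrite lerN2.
  by rewrite dotNr lerN2.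
have agree x : D x -> v x = - vn x.
  move=> Dx; apply/eqP; rewrite eq_le (hcomparison _ _ v_sub vn_super)//=.
  exact: (relaxed_liminf_le_limsup thin_ne e1_gt0 u_bounded Dx).
have v_super : P0_super Omega G L beta v.
  apply: (visc_super_eq (u := fun x => - vn x)) vn_super => x Dx.
    by rewrite agree.
  exact: (relaxed_limit_lsc_env thin_ne e1_gt0 u_bounded agree).
exists v; split => //.
- move=> u1 [u1_sub u1_super] x Dx; apply/eqP; rewrite eq_le.
  by rewrite (hcomparison _ _ u1_sub v_super)// (hcomparison _ _ v_sub u1_super).
- apply: cvg0_ereal_sup.
    move=> e e0; have [x Ox] := hne.
    by have [z Kz _] := thin_column hg e0 Ox; exists z.
  exact: (relaxed_limit_uniform thin_ne e1_gt0 u_bounded compD xK agree).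
Qed.
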